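(* Fix integers $m \ge 2$, $n \ge 4$, $1 \le h \le n-3$, and real numbers $c_{i,\sigma}$ for $1 \le i \le m$, $\sigma \in S_n$ (independent of $q$). Let $q$ range over powers of primes $p$, where if $m \ge 3$ one additionally requires $p > n$. For each such $q$, let $\varphi_1,\dots,\varphi_m : M_n(\mathbb{F}_q) \to \mathbb{R}$ be the arithmetic functions of von Mangoldt type with coefficients $(c_{i,\sigma})_{\sigma \in S_n}$, respectively. Then as $q \to \infty$, \[ \frac{1}{q^n} \sum_{f \in M_n(\mathbb{F}_q)} \prod_{i=1}^m \sum_{\substack{g \in \mathbb{F}_q[x]\\ \deg g \le h}} \varphi_i(f+g) = \prod_{i=1}^m \Big( \sum_{\tau \in S_n} c_{i,\tau}\, q^{h+1} \Big) + O\big(q^{(h+1)(m-1)}\big), \] with the implied constant depending on $m$, $n$, $h$ and the coefficients.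
   Context: $M_n(\mathbb{F}_q)$ is the set of monic degree-$n$ polynomials in $\mathbb{F}_q[x]$; the inner sum is over all $g \in \mathbb{F}_q[x]$ of degree $\le h$ (including $g=0$). For $(z_1,\dots,z_n) \in \overline{\mathbb{F}}_q^{\,n}$ and $\sigma \in S_n$, let $\delta_\sigma(z_1,\dots,z_n) = 1$ if $\mathrm{Frob}_q(z_1,\dots,z_n) = \sigma(z_1,\dots,z_n)$ (Frobenius $z \mapsto z^q$ applied coordinatewise equals the permutation $\sigma$ of coordinates) and $0$ otherwise. A function $\varphi : M_n(\mathbb{F}_q) \to \mathbb{R}$ is of von Mangoldt type with coefficients $(c_\sigma)_{\sigma \in S_n}$ if for all $f \in M_n(\mathbb{F}_q)$, \[ \varphi(f) = \sum_{\substack{(z_1,\dots,z_n) \in \overline{\mathbb{F}}_q^{\,n}\\ f = \prod_i (x - z_i)}} \sum_{\sigma \in S_n} c_\sigma \delta_\sigma(z_1,\dots,z_n). \] *)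

(* Defs.v *)
From HB Require Import structures.
From mathcomp Require Import all_boot all_order all_algebra all_fingroup all_field.
From mathcomp Require Import reals.
Set Implicit Arguments. Unset Strict Implicit. Unset Printing Implicit Defensive.
Import Order.TTheory GRing.Theory Num.Theory.
Local Open Scope ring_scope.

(* The monic polynomial x^n + a_{n-1} x^{n-1} + ... + a_0 ; as a ranges over
   {ffun 'I_n -> F} this enumerates M_n(F) bijectively. *)
Definition monic_of (F : fieldType) (n : nat) (a : {ffun 'I_n -> F}) : {poly F} :=
  'X^n + \sum_(i < n) a i *: 'X^i.

(* The polynomial b_0 + b_1 x + ... + b_h x^h ; as b ranges over
   {ffun 'I_h.+1 -> F} this enumerates all g with deg g <= h (including g = 0). *)
Definition poly_le_of (F : fieldType) (h : nat) (b : {ffun 'I_h.+1 -> F}) : {poly F} :=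
  \sum_(i < h.+1) b i *: 'X^i.

Definition frob_perm (L : fieldType) (q n : nat) (s : 'S_n) (z : {ffun 'I_n -> L}) : bool :=
  [forall i, z i ^+ q == z (s i)].

(* phi : M_n(F_q) -> R is of von Mangoldt type with coefficients c, where the
   algebraic closure of F is realised as an algebraically closed field L with an
   embedding iota : F -> L such that L is algebraic over iota(F).  The sum over the
   (finitely many) tuples z in L^n with f = prod (x - z_i) is written as a sum over
   a duplicate-free list s enumerating exactly those tuples. *)
Definition von_mangoldt_type (F : finFieldType) (R : realType) (n : nat)
    (c : 'S_n -> R) (phi : {poly F} -> R) : Prop :=
  exists (L : closedFieldType) (iota : {rmorphism F -> L}),
    integralRange iota /\
    forall f : {poly F}, f \is monic -> size f = n.+1 ->
      exists s : seq {ffun 'I_n -> L},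
        [/\ uniq s,
            (forall z, z \in s <-> map_poly iota f = \prod_(i < n) ('X - (z i)%:P)) &
            phi f = \sum_(z <- s) \sum_(sg : 'S_n) c sg * (frob_perm #|F| sg z)%:R].

(* Main.v *)
Require Import Defs.
From HB Require Import structures.
From mathcomp Require Import all_boot all_order all_algebra all_fingroup all_field.
From mathcomp Require Import all_character zify ring lra.
From mathcomp Require Import reals.
Set Implicit Arguments. Unset Strict Implicit. Unset Printing Implicit Defensive.
Import Order.TTheory GRing.Theory Num.Theory.
Local Open Scope ring_scope.

(* Write [k = n - h - 1] and let [G] be the group of power series [1 + x F[[x]]] modulo
   [x ^ (k + 1)], of order [q ^ k].  Reversing the coefficients of a monic [f] of degree [n]
   gives its class in [G], and a short interval is a fibre of this class map, so a short sum
   of [phi] is a function on [G].  It is bounded by [O(q ^ (h + 1))], with explicit mean, so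
   expanding the product to second order around the means leaves only an [O(q ^ (h + 1))]
   bound for the variance of each factor; this needs no condition on the characteristic.

   By Plancherel on [G] the variance is a sum over the nontrivial characters [chi] of [G],
   and for a permutation with cycle lengths [d_1, d_2, ...] the [chi]-component is the product
   of the sums [S_d = \sum_z chi (class of N_d z)] over [z] in [F_(q ^ d)], for [d = d_j],
   where [N_d z] is the characteristic polynomial of [z] over [F].  So one needs Weil's
   bound [S_d = O(q ^ (d / 2))].

   The sums of [chi] over all monic polynomials of degree [>= k] vanish, and the Newton
   identities turn this into [S_d = - \sum_j a_j ^ d] with at most [k] numbers [a_j].  Hence
   it suffices to bound [S_d] by a multiple of [q ^ (d / 2)] for large even [d], with any
   constant.  This is done by Stepanov's method with a polynomial in one variable, which
   bounds the number of [z] in [F_(q ^ d)] whose class is a given element of [G]. *)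


(** * Linear combinations of polynomials *)

Section PolynomialCombinations.
Variables (F : fieldType) (I : finType).

(** The coefficient matrix has more rows than columns, so its left kernel is nonzero. *)
Lemma exists_vanishing_combination (D : nat) (T : I -> {poly F}) :
    (D < #|I|)%N -> (forall i, size (T i) <= D)%N ->
  exists c : I -> F, (exists i, c i != 0) /\ \sum_i c i *: T i = 0.
Proof.
move=> ltD sT.
pose A : 'M[F]_(#|I|, D) := \matrix_(i, j) (T (enum_val i))`_j.
have: kermx A != 0.
  rewrite kermx_eq0 /row_free; apply: contraTneq (rank_leq_col A) => ->.
  by rewrite -ltnNge.
case/rowV0Pn=> v /sub_kermxP vA /rV0Pn[i0 vi0].
exists (fun i => v 0 (enum_rank i)); split.
  by exists (enum_val i0); rewrite enum_valK.
apply/polyP=> j; rewrite coef0 coef_sum.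
have [ltjD | leDj] := ltnP j D; last first.
  by rewrite big1 // => i _; rewrite coefZ [_`_j]nth_default ?mulr0 // (leq_trans (sT i)).
have /rowP/(_ (Ordinal ltjD)) := vA; rewrite !mxE => vAj; rewrite -[RHS]vAj.
rewrite (reindex _ (onW_bij _ (@enum_val_bij I))) /=.
by apply: eq_bigr => i _; rewrite coefZ enum_valK mxE.
Qed.

(** The largest [M i] with [c i != 0] has a leading coefficient that no other term can cancel. *)
Lemma combination_distinct_sizes_neq0 (M : I -> {poly F}) (c : I -> F) :
    injective (fun i => size (M i)) -> (forall i, M i != 0) ->
  (exists i, c i != 0) -> \sum_i c i *: M i != 0.
Proof.
move=> injM nzM [i0 ci0].
case: (@arg_maxnP _ i0 (fun i => c i != 0) (fun i => size (M i)) ci0) => i ci maxi.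
have: (\sum_i c i *: M i)`_(size (M i)).-1 != 0.
  rewrite coef_sum (bigD1 i) //= big1 ?addr0 => [|j ji].
    by rewrite coefZ mulf_neq0 // -lead_coefE lead_coef_eq0.
  have [->|cj] := eqVneq (c j) 0; first by rewrite scale0r coef0.
  rewrite coefZ [_`__]nth_default ?mulr0 //.
  have /= := maxi j cj; rewrite /geq /= leq_eqVlt => /orP[/eqP Eij|]; last by case: (size (M i)).
  by rewrite (injM _ _ Eij) eqxx in ji.
by apply: contraNneq => ->; rewrite coef0.
Qed.

End PolynomialCombinations.

(** * Frobenius on an algebraically closed field containing [F] *)

Section Frobenius.
Variables (F : finFieldType) (L : closedFieldType) (iota : {rmorphism F -> L}).
Local Notation q := #|F|.

Lemma card_pchar_nat i : [pchar L].-nat (q ^ i)%N.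
Proof.
rewrite pnatX; apply/orP; left.
have [p p_pr pF] := finPcharP F.
rewrite (card_pprimeChar pF) pnatX pnatE //; apply/orP; left.
by rewrite inE p_pr -(rmorph_nat iota) (pcharf0 pF) rmorph0 eqxx.
Qed.

Lemma card_natr_eq0 d : (0 < d)%N -> (q ^ d)%:R = 0 :> L.
Proof.
move=> d_gt0; have [p p_pr pF] := finPcharP F.
have := finNzRing_gt1 F; rewrite (card_pprimeChar pF) -expnM.
case: (logn _ _) => [|n _]; first by rewrite expn0.
by rewrite mulSn natrX -(rmorph_nat iota) (pcharf0 pF) rmorph0 expr0n; case: d d_gt0.
Qed.

(* [f] only serves to find the ring morphism structure: it makes [#|F|] a power
   of the characteristic of [L]. *)
Definition frob (f : {rmorphism F -> L}) (i : nat) (x : L) : L := x ^+ (q ^ i).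

Lemma frob_is_zmod_morphism i : zmod_morphism (frob iota i).
Proof. by move=> x y; rewrite /frob exprDn_pchar ?exprNn_pchar // card_pchar_nat. Qed.

Lemma frob_is_monoid_morphism i : monoid_morphism (frob iota i).
Proof. by split=> [|x y]; rewrite /frob ?expr1n ?exprMn. Qed.

HB.instance Definition _ i :=
  GRing.isZmodMorphism.Build L L (frob iota i) (frob_is_zmod_morphism i).
HB.instance Definition _ i :=
  GRing.isMonoidMorphism.Build L L (frob iota i) (frob_is_monoid_morphism i).

Lemma frobE i x : frob iota i x = x ^+ (q ^ i).
Proof. by []. Qed.

Lemma frob0 x : frob iota 0 x = x.
Proof. by rewrite /frob expn0 expr1. Qed.

Lemma frob_comp i j x : frob iota i (frob iota j x) = frob iota (i + j) x.
Proof. by rewrite /frob -exprM -expnD addnC. Qed.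

Lemma frob_inj i : injective (frob iota i).
Proof. exact: fmorph_inj. Qed.

Lemma frob_iota i x : frob iota i (iota x) = iota x.
Proof.
rewrite /frob -rmorphXn; congr (iota _).
by elim: i => [|i IHi]; rewrite ?expn0 ?expr1 // expnS exprM expf_card.
Qed.

Lemma frob_fix_iter d t x : frob iota d x = x -> frob iota (d * t) x = x.
Proof.
move=> fx; elim: t => [|t IHt]; first by rewrite muln0 frob0.
by rewrite mulnS -frob_comp IHt.
Qed.

(** The product of the ['X - y] over [y] in [F] is ['X^q - 'X]; it vanishes at a fixed point, so one
    of its factors does. *)
Lemma frob1_fixed x : frob iota 1 x = x -> exists y, x = iota y.
Proof.
rewrite /frob expn1 => fx.
have /(congr1 (fun p => (map_poly iota p).[x])) := finField_genPoly F.
rewrite rmorphB /= map_polyXn map_polyX !hornerE fx subrr.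
rewrite rmorph_prod horner_prod /= => /esym/eqP/prodf_eq0[y _].
by rewrite rmorphB /= map_polyX map_polyC !hornerE subr_eq0 => /eqP ->; exists y.
Qed.

Lemma map_frob_iota i (p : {poly F}) :
  map_poly (frob iota i) (map_poly iota p) = map_poly iota p.
Proof. by apply/polyP=> j; rewrite !coef_map /= frob_iota. Qed.

Lemma horner_frob i (p : {poly F}) x :
  frob iota i (map_poly iota p).[x] = (map_poly iota p).[frob iota i x].
Proof. by rewrite -horner_map /= map_frob_iota. Qed.

(** A one-sided inverse of [iota]; outside the image the value is the default [0]. *)
Definition descend (y : L) : F := odflt 0 [pick x | iota x == y].

Lemma descendK p : map_poly (frob iota 1) p = p ->
  map_poly iota (map_poly descend p) = p.
Proof.
move=> fp; apply/polyP=> j; rewrite coef_map /=.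
have [ltj|lej] := ltnP j (size p); last first.
  by rewrite [RHS]nth_default // nth_default ?rmorph0 // (leq_trans (size_poly _ _)).
rewrite coef_poly ltj /descend.
have [y Dy] : exists y, p`_j = iota y by apply: frob1_fixed; rewrite -{2}fp coef_map.
by case: pickP => [x /eqP //|/(_ y)]; rewrite Dy eqxx.
Qed.

(* [\prod_(i < d) ('X - z ^ (q ^ i))]: the characteristic polynomial of [z] over
   [F] when [z] lies in the extension of [F] of degree [d]. *)
Definition frob_charpoly (d : nat) (z : L) : {poly L} :=
  \prod_(i < d) ('X - (frob iota i z)%:P).

Definition charpoly_over (d : nat) (z : L) : {poly F} :=
  map_poly descend (frob_charpoly d z).

(** Frobenius sends the factor of index [i] to that of index [i + 1], and [frob d z = z] closes the
    cycle. *)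
Lemma frob_charpoly_fixed d z : frob iota d z = z ->
  map_poly (frob iota 1) (frob_charpoly d z) = frob_charpoly d z.
Proof.
rewrite /frob_charpoly rmorph_prod /= => fz.
have shift i : map_poly (frob iota 1) ('X - (frob iota i z)%:P)
             = 'X - (frob iota i.+1 z)%:P.
  by rewrite rmorphB /= map_polyX map_polyC /= frob_comp add1n.
under eq_bigr do rewrite shift.
case: d fz => [|d] fz; first by rewrite !big_ord0.
by rewrite big_ord_recr [RHS]big_ord_recl /= fz frob0 mulrC.
Qed.

Lemma map_charpoly_over d z : frob iota d z = z ->
  map_poly iota (charpoly_over d z) = frob_charpoly d z.
Proof. by move=> fz; rewrite descendK ?frob_charpoly_fixed. Qed.

Lemma frob_charpoly_monic d z : frob_charpoly d z \is monic.
Proof. exact: monic_prod_XsubC. Qed.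

Lemma size_frob_charpoly d z : size (frob_charpoly d z) = d.+1.
Proof. by rewrite size_prod_XsubC /index_enum -enumT size_enum_ord. Qed.

Lemma charpoly_over_monic d z : frob iota d z = z -> charpoly_over d z \is monic.
Proof.
by move=> fz; rewrite -(map_monic iota) map_charpoly_over ?frob_charpoly_monic.
Qed.

Lemma size_charpoly_over d z : frob iota d z = z -> size (charpoly_over d z) = d.+1.
Proof.
by move=> fz; rewrite -(size_map_poly iota) map_charpoly_over ?size_frob_charpoly.
Qed.

(** These are the roots of ['X^(q ^ d) - 'X], distinct because its derivative is [-1]: the field
    with [q ^ d] elements inside [L]. *)
Lemma frob_points_exist d : (0 < d)%N ->
  {s : seq L | [/\ uniq s, size s = (q ^ d)%N & s =i [pred z | frob iota d z == z]]}.
Proof.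
move=> d_gt0; pose p : {poly L} := 'X^(q ^ d) - 'X.
have qd_gt1: (1 < q ^ d)%N by rewrite -{1}(exp1n d) ltn_exp2r // finNzRing_gt1.
have szX: (size (- 'X : {poly L})%R < (q ^ d).+1)%N by rewrite size_polyN size_polyX ltnS.
have sz: size p = (q ^ d).+1 by rewrite size_polyDl size_polyXn.
have lc: lead_coef p = 1 by rewrite lead_coefDl ?size_polyXn // lead_coefXn.
have [s] := closed_field_poly_normal p; rewrite lc scale1r => Dp.
exists s; split.
- rewrite -separable_prod_XsubC -Dp unlock /p derivB derivX derivXn.
  by rewrite -mulr_natr -polyC_natr card_natr_eq0 // mulr0 sub0r
    -[X in coprimep _ X]scaleN1r coprimepZr ?oppr_eq0 ?oner_eq0 // coprimep1.
- by apply: eq_add_S; rewrite -sz Dp size_prod_XsubC.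
- move=> z; rewrite inE -root_prod_XsubC -Dp /p rootE !hornerE.
  by rewrite subr_eq0.
Qed.

End Frobenius.

(** * Stepanov's method *)

Section DegreeDigits.
Variable q : nat.

(** For [j <= k], the sum of the [j] largest among [1, q, ..., q ^ (k - 1)]. It is the degree of the
    [j]-th elementary symmetric function of [X, X ^ q, ..., X ^ (q ^ (k - 1))]. *)
Definition digit_weight (k j : nat) : nat := (\sum_(i < j) q ^ (k - i.+1))%N.

Lemma digit_weightS k j : digit_weight k.+1 j.+1 = (q ^ k + digit_weight k j)%N.
Proof. by rewrite /digit_weight big_ord_recl subn1. Qed.

Lemma digit_weight_scale k e j : (j <= k)%N -> (k <= e)%N ->
  digit_weight e j = (q ^ (e - k) * digit_weight k j)%N.
Proof.
move=> lejk leke; rewrite /digit_weight big_distrr /=; apply: eq_bigr => i _.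
by rewrite -expnD; congr (_ ^ _)%N; have := ltn_ord i; lia.
Qed.

Lemma digit_weight_lt e j : (1 < q)%N -> (digit_weight e j < q ^ e)%N || (e < j)%N.
Proof.
move=> q_gt1; elim: e j => [|e IHe] [|j].
- by rewrite /digit_weight big_ord0.
- by rewrite orbT.
- by rewrite /digit_weight big_ord0 expn_gt0 (ltnW q_gt1).
rewrite digit_weightS ltnS; case/orP: (IHe j) => [ltj|->]; last by rewrite orbT.
apply/orP; left; rewrite expnS.
by apply: leq_trans (leq_mul q_gt1 (leqnn _)); rewrite mul2n -addnn ltn_add2l.
Qed.

(** The last weight is [1] modulo [q] and the others are divisible by [q]. So the last digit is read
    off modulo [q], and dividing by [q] leaves the same problem with one digit fewer. *)
Lemma digit_weight_inj k (f g : nat -> nat) : (0 < q)%N ->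
    (forall j, f j < q)%N -> (forall j, g j < q)%N ->
    \sum_(j < k) f j * digit_weight k j.+1
      = \sum_(j < k) g j * digit_weight k j.+1 %[mod q ^ k] ->
  forall j, (j < k)%N -> f j = g j.
Proof.
move=> q_gt0 ltf ltg; elim: k => // k IHk.
pose w := digit_weight k k.
have expand (h : nat -> nat) :
  (\sum_(j < k.+1) h j * digit_weight k.+1 j.+1
    = q * (\sum_(j < k) h j * digit_weight k j.+1 + h k * w) + h k)%N.
  rewrite big_ord_recr /= mulnDr [(q * \sum_(j < k) _)%N]big_distrr /= -addnA.
  congr (_ + _)%N.
    apply: eq_bigr => j _; rewrite (@digit_weight_scale k k.+1) //.
    by rewrite subSnn expn1 mulnCA.
  rewrite /digit_weight big_ord_recr /= subnn expn0 mulnDr muln1; congr (_ + _)%N.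
  rewrite mulnCA; congr (_ * _)%N; rewrite /w /digit_weight big_distrr /=.
  by apply: eq_bigr => i _; rewrite -expnS; congr (_ ^ _)%N; have := ltn_ord i; lia.
rewrite !expand => E.
have Ek : f k = g k.
  have /(congr1 (modn^~ q)) := E; rewrite expnS !modn_dvdm ?dvdn_mulr //.
  by rewrite ![(q * _)%N]mulnC !modnMDl !modn_small.
move/eqP: E; rewrite Ek eqn_modDr expnS -!muln_modr // eqn_pmul2l // eqn_modDr.
move=> /eqP/IHk E j; rewrite ltnS leq_eqVlt => /orP[/eqP -> //|]; exact: E.
Qed.

(** All weights are multiples of [q ^ (e - k)], so [a] is a remainder modulo that power;
    [digit_weight_inj] then recovers the digits, and [b] is what remains. This makes the degrees of
    Stepanov's monomials distinct. *)
Lemma mixed_radix_inj k e a a' b b' (f g : nat -> nat) : (0 < q)%N -> (k <= e)%N ->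
    (a < q ^ (e - k))%N -> (a' < q ^ (e - k))%N ->
    (forall j, f j < q)%N -> (forall j, g j < q)%N ->
    (a + \sum_(j < k) f j * digit_weight e j.+1 + q ^ e * b
      = a' + \sum_(j < k) g j * digit_weight e j.+1 + q ^ e * b')%N ->
  [/\ a = a', b = b' & forall j, (j < k)%N -> f j = g j].
Proof.
move=> q_gt0 leke lta lta' ltf ltg.
set A := (q ^ (e - k))%N in lta lta' *.
have Dr : (q ^ e = A * q ^ k)%N by rewrite -expnD subnK.
have A_gt0 : (0 < A)%N by rewrite expn_gt0 q_gt0.
have expand (h : nat -> nat) :
  (\sum_(j < k) h j * digit_weight e j.+1
     = A * \sum_(j < k) h j * digit_weight k j.+1)%N.
  rewrite big_distrr; apply: eq_bigr => j _.
  by rewrite (digit_weight_scale (k := k)) //= mulnCA.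
rewrite !expand Dr -!mulnA -!addnA -!mulnDr ![(A * _)%N]mulnC => E.
have Ea : a = a'.
  by have /(congr1 (modn^~ A)) := E; rewrite ![(a + _)%N]addnC ![(a' + _)%N]addnC
    !modnMDl !modn_small.
move/eqP: E; rewrite Ea eqn_add2l eqn_pmul2r // => /eqP E.
have Ef : forall j, (j < k)%N -> f j = g j.
  apply: digit_weight_inj => //; have /(congr1 (modn^~ (q ^ k)%N)) := E.
  by rewrite ![(q ^ k * _)%N]mulnC ![(_ + _ * q ^ k)%N]addnC !modnMDl.
split=> //; move/eqP: E.
rewrite (eq_bigr (fun j : 'I_k => g j * digit_weight k j.+1)%N) => [|j _].
  by rewrite eqn_add2l eqn_pmul2l ?expn_gt0 ?q_gt0 // => /eqP.
by rewrite Ef.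
Qed.

End DegreeDigits.

Section Degrees.
Variable F : fieldType.
Implicit Types (p : {poly F}).

Lemma size_mulS p p' d d' : size p = d.+1 -> size p' = d'.+1 -> size (p * p') = (d + d').+1%N.
Proof.
move=> sp sp'; rewrite size_mul ?sp ?sp' ?addSn ?addnS //.
- by rewrite -size_poly_gt0 sp.
- by rewrite -size_poly_gt0 sp'.
Qed.

Lemma size_expS p d n : size p = d.+1 -> size (p ^+ n) = (n * d).+1%N.
Proof.
move=> sp; elim: n => [|n IHn]; first by rewrite expr0 size_poly1.
by rewrite exprS mulSn; apply: size_mulS.
Qed.

Lemma size_prodS (I : finType) (P : I -> {poly F}) (d : I -> nat) :
  (forall i, size (P i) = (d i).+1) -> size (\prod_i P i) = (\sum_i d i).+1%N.
Proof.
move=> sP; elim/big_rec2: _ => [|i n p _ sp]; first by rewrite size_poly1.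
exact: size_mulS.
Qed.

Lemma size_mul_leS p p' d d' :
  (size p <= d.+1)%N -> (size p' <= d'.+1)%N -> (size (p * p')%R <= (d + d').+1)%N.
Proof.
move=> sp sp'; apply: leq_trans (size_polyMleq _ _) _.
by rewrite -subn1 leq_subLR add1n (leq_trans (leq_add sp sp')) ?addSn ?addnS.
Qed.

Lemma size_exp_leS p d n : (size p <= d.+1)%N -> (size (p ^+ n)%R <= (n * d).+1)%N.
Proof.
move=> sp; elim: n => [|n IHn]; first by rewrite expr0 size_poly1.
by rewrite exprS mulSn; apply: size_mul_leS.
Qed.

Lemma size_prod_leS (I : finType) (P : I -> {poly F}) (d : I -> nat) :
  (forall i, size (P i) <= (d i).+1)%N -> (size (\prod_i P i)%R <= (\sum_i d i).+1)%N.
Proof.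
move=> sP; elim/big_rec2: _ => [|i n p _ sp]; first by rewrite size_poly1.
exact: size_mul_leS.
Qed.

End Degrees.

(** * Products of linear factors and their truncated inverses *)

Section TruncatedProducts.
Variable R : comNzRingType.
Implicit Types (p : {poly R}) (x : nat -> R).

Definition eq_coefs (k : nat) p p' := forall j, (j <= k)%N -> p`_j = p'`_j.

Lemma eq_coefsM k p p' s s' : eq_coefs k p p' -> eq_coefs k s s' -> eq_coefs k (p * s) (p' * s').
Proof.
move=> Ep Es j lejk; rewrite !coefM; apply: eq_bigr => i _.
have leij : (i <= j)%N by rewrite -ltnS.
by rewrite Ep ?Es // (leq_trans _ lejk) // leq_subr.
Qed.

(** The reversal of the product of the ['X - x i]; up to sign its coefficients are the elementary
    symmetric functions of the [x i]. *)
Definition lin_prod (e : nat) x : {poly R} := \prod_(i < e) (1 - (x i)%:P * 'X).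

(** An inverse of [lin_prod e x] modulo ['X^k.+1], built from geometric series cut after degree
    [k]. *)
Definition geom_prod (k e : nat) x : {poly R} := \prod_(i < e) \poly_(l < k.+1) (x i ^+ l).

Lemma lin_prod_add d e x : lin_prod (d + e) x = lin_prod d x * lin_prod e (fun i => x (d + i)%N).
Proof. by rewrite /lin_prod big_split_ord. Qed.

Lemma eq_lin_prod e x y : x =1 y -> lin_prod e x = lin_prod e y.
Proof. by move=> E; apply: eq_bigr => i _; rewrite E. Qed.

Lemma coef_lin_prodS e x j :
  (lin_prod e.+1 x)`_j.+1 = (lin_prod e x)`_j.+1 - x e * (lin_prod e x)`_j.
Proof.
rewrite {1}/lin_prod big_ord_recr /= mulrBr mulr1 coefB; congr (_ - _).
by rewrite mulrA coefMX /= coefMC mulrC.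
Qed.

Lemma coef0_lin_prod e x : (lin_prod e x)`_0 = 1.
Proof.
elim: e => [|e IHe]; first by rewrite /lin_prod big_ord0 coef1.
by rewrite /lin_prod big_ord_recr /= mulrBr mulr1 coefB mulrA coefMX /= subr0.
Qed.

Lemma coef_lin_prod_gt e x j : (e < j)%N -> (lin_prod e x)`_j = 0.
Proof.
elim: e j => [|e IHe] [|j] //; first by rewrite /lin_prod big_ord0 coef1.
by rewrite ltnS => lt_ej; rewrite coef_lin_prodS !IHe ?mulr0 ?subr0 // ltnW.
Qed.

Lemma lin_geom_prod k e x : eq_coefs k (lin_prod e x * geom_prod k e x) 1.
Proof.
rewrite /lin_prod /geom_prod -big_split /=.
elim/big_ind: _ => [//|p p' Ep Ep'|i _].
  by rewrite -[X in eq_coefs _ _ X]mulr1; apply: eq_coefsM.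
move=> j lejk; rewrite mulrBl mul1r -mulrA -commr_polyX mulrA coefB coefMX coefCM coef1.
case: j lejk => [|j] ltjk; first by rewrite coef_poly /= subr0.
by rewrite !coef_poly ltnS ltjk ltnS (ltnW ltjk) exprS subrr.
Qed.

End TruncatedProducts.

Lemma map_lin_prod (R S : comNzRingType) (f : {rmorphism R -> S}) e (x : nat -> R) :
  map_poly f (lin_prod e x) = lin_prod e (fun i => f (x i)).
Proof.
rewrite /lin_prod rmorph_prod; apply: eq_bigr => i _ /=.
by rewrite rmorphB rmorph1 rmorphM /= map_polyC map_polyX.
Qed.

Section CoefficientDegrees.
Variables (F : fieldType) (q : nat).
Hypothesis q_gt1 : (1 < q)%N.

Definition coef_deg_le (s : nat) (P : {poly {poly F}}) :=
  forall j, (size (P`_j)%R <= (s * j).+1)%N.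

Lemma coef_deg_leM s P P' : coef_deg_le s P -> coef_deg_le s P' -> coef_deg_le s (P * P').
Proof.
move=> sP sP' j; rewrite coefM; apply: leq_trans (size_sum _ _ _) _.
apply/bigmax_leqP=> i _; apply: leq_trans (size_mul_leS (sP _) (sP' _)) _.
by rewrite -mulnDr subnKC // -ltnS.
Qed.

Lemma coef_deg_leC s (p : {poly F}) : coef_deg_le s (map_poly polyC p).
Proof. by move=> j; rewrite coef_map; apply: leq_trans (size_polyC_leq1 _) _. Qed.

Lemma coef_deg_geom_prod s k e (x : nat -> {poly F}) :
  (forall i, (i < e)%N -> (size (x i) <= s.+1)%N) -> coef_deg_le s (geom_prod k e x).
Proof.
move=> sx; rewrite /geom_prod; elim/big_ind: _ => [j||i _ j].
- by rewrite coef1; case: (j == 0)%N; rewrite ?size_poly1 ?size_poly0.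
- exact: coef_deg_leM.
- rewrite coef_poly; case: ifP => _; last by rewrite size_poly0.
  by rewrite mulnC size_exp_leS // sx.
Qed.

(** When the last factor is added, the new term of degree [q ^ e + digit_weight q e j] dominates:
    the old coefficient is zero or has degree below [q ^ e]. *)
Lemma size_coef_lin_prod e j : (j <= e)%N ->
  size (lin_prod e (fun i => 'X^(q ^ i) : {poly F}))`_j = (digit_weight q e j).+1.
Proof.
elim: e j => [|e IHe] [|j] lej //.
- by rewrite coef0_lin_prod size_poly1 /digit_weight big_ord0.
- by rewrite coef0_lin_prod size_poly1 /digit_weight big_ord0.
rewrite coef_lin_prodS addrC digit_weightS.
have s2 : size (- ('X^(q ^ e) * (lin_prod e (fun i => 'X^(q ^ i) : {poly F}))`_j))
    = (q ^ e + digit_weight q e j).+1.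
  by rewrite size_polyN; apply: size_mulS; rewrite ?size_polyXn ?IHe.
rewrite size_polyDl ?s2 //.
have [lt_ej|le_je] := ltnP e j.+1; first by rewrite coef_lin_prod_gt // size_poly0.
rewrite IHe // !ltnS; 
have [|] := orP (digit_weight_lt e j.+1 q_gt1); last by rewrite ltnS leqNgt le_je.
by move/leq_trans=> -> //; rewrite leq_addr.
Qed.

End CoefficientDegrees.

(** * The auxiliary polynomial and the resulting point count *)

Section Stepanov.
Variables (F : finFieldType) (L : closedFieldType) (iota : {rmorphism F -> L}).
Local Notation q := #|F|.
Local Notation frob := (frob iota).

Let eval_at (z : L) : {rmorphism {poly F} -> L} := horner_eval z \o map_poly iota.

(* Write [r = q ^ e]. With [B = lin_prod e (X ^ (q ^ i))], a point [z] of the set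
   satisfies [z ^ (r ^ 2) = z] and [B(z) * B(z) ^ (r) = gamma] modulo ['X^k.+1], so that
   the [r]-th power of each coefficient of [B(z)] is a polynomial of low degree in [z],
   namely a coefficient of [H = B ^ -1 * gamma].  Applied to the monomials [M i], this gives
   polynomials [T i] with [M i ^ r = T i] on the set; as [T] takes values in a space of
   dimension less than the number of monomials, some [u = \sum_i c i *: M i] vanishes on the
   set, and [u <> 0] because the [M i] have distinct degrees. *)
Lemma stepanov_bound k e (gamma : {poly F}) (s : seq L) :
    (k <= e)%N -> (k * k * q + 2 < q ^ e)%N -> uniq s ->
    (forall z, z \in s -> frob (e + e) z = z /\
       eq_coefs k (lin_prod (e + e) (fun i => frob i z)) (map_poly iota gamma)) ->
  (size s * q ^ k <= q ^ (e + e) + (1 + q ^ k * (k * q + k * k * q + 2)) * q ^ e)%N.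
Proof.
move=> leke big_e uniq_s sP.
have q_gt1 : (1 < q)%N := finNzRing_gt1 F.
have q_gt0 : (0 < q)%N := ltnW q_gt1.
(* The index type has [A * q ^ k * Bm = r * Bm] elements. [Bm] is chosen so that this exceeds the
   bound [r * A + k * k * q * r + Bm] on the sizes of the [T i], which amounts to [Bm < 2 * r]. *)
pose r := (q ^ e)%N; pose A := (q ^ (e - k))%N; pose Bm := (A + k * k * q + 2)%N.
have Dr : (A * q ^ k = r)%N by rewrite -expnD subnK.
have leAr : (A <= r)%N by rewrite leq_pexp2l // leq_subr.
pose x i : {poly F} := 'X^(q ^ i).
pose B := lin_prod e x; pose H := geom_prod k e x * map_poly polyC gamma.
have sH : coef_deg_le r H.
  apply: coef_deg_leM (@coef_deg_leC _ _ _).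
  by apply: coef_deg_geom_prod => i lti; rewrite size_polyXn ltnS leq_pexp2l // ltnW.
pose I := ('I_A * {ffun 'I_k -> 'I_q} * 'I_Bm)%type.
pose M (i : I) : {poly F} :=
  'X^(i.1.1) * (\prod_(j < k) B`_j.+1 ^+ i.1.2 j) * 'X^(r * i.2).
(* Raising to the power [r] at a point [z] turns [z ^ a] into [z ^ (r * a)], coefficients of [B]
   into those of [H], and [z ^ (r * b)] back into [z ^ b]. *)
pose T (i : I) : {poly F} :=
  'X^(r * i.1.1) * (\prod_(j < k) H`_j.+1 ^+ i.1.2 j) * 'X^(i.2).
have sM i : size (M i) =
    (i.1.1 + \sum_(j < k) i.1.2 j * digit_weight q e j.+1 + r * i.2).+1.
  rewrite /M; apply: size_mulS; rewrite ?size_polyXn //.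
  apply: size_mulS; rewrite ?size_polyXn //; apply: size_prodS => j.
  by apply: size_expS; rewrite size_coef_lin_prod // (leq_trans _ leke).
have sum_digits (d : nat -> nat) m (f : {ffun 'I_k -> 'I_q}) :
    (forall j, (j < k)%N -> d j <= m)%N -> (\sum_(j < k) f j * d j <= k * q * m)%N.
  move=> led; apply: (@leq_trans (\sum_(j < k) q * m)%N).
    by apply: leq_sum => j _; rewrite leq_mul ?led // ltnW.
  by rewrite sum_nat_const card_ord mulnA.
have sT i : (size (T i) <= r * A + k * k * q * r + Bm)%N.
  have sT1 : (size (T i) <= (r * i.1.1 + \sum_(j < k) i.1.2 j * (r * j.+1) + i.2).+1)%N.
    rewrite /T; apply: size_mul_leS; rewrite ?size_polyXn //.
    apply: size_mul_leS; rewrite ?size_polyXn //; apply: size_prod_leS => j.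
    exact: size_exp_leS.
  apply: (leq_trans sT1); rewrite -addnS; apply: leq_add; last exact: ltn_ord.
  apply: leq_add; first by rewrite leq_mul // ltnW.
  apply: leq_trans (sum_digits (fun j => r * j.+1)%N (r * k)%N _ _) _.
    by move=> j ltj; rewrite leq_mul.
  by apply/eq_leq; ring.
have cardI : #|{: I}| = (r * Bm)%N.
  by rewrite !card_prod !card_ord card_ffun !card_ord Dr.
have [|c [nzc cT]] := @exists_vanishing_combination F I _ T _ sT.
  rewrite cardI /Bm !mulnDr -!addnA ltn_add2l mulnC ltn_add2l /Bm.
  have: (A + (k * k * q + 2) < r * 2)%N by rewrite muln2 -addnn -addnS leq_add.
  by [].
pose u := \sum_i c i *: M i.
have nzM i : M i != 0 by rewrite -size_poly_gt0 sM.
have nzu : u != 0.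
  apply: combination_distinct_sizes_neq0 => // i i' /= /eqP.
  rewrite !sM eqSS => /eqP E; pose dig (f : {ffun 'I_k -> 'I_q}) (j : nat) : nat :=
    if insub j is Some j' then val (f j') else 0%N.
  have ltdig f j : (dig f j < q)%N by rewrite /dig; case: insub => [j'|] //=.
  have digE (f : {ffun 'I_k -> 'I_q}) (j : 'I_k) : dig f j = f j by rewrite /dig valK.
  have digsum (f : {ffun 'I_k -> 'I_q}) : (\sum_(j < k) f j * digit_weight q e j.+1
      = \sum_(j < k) dig f j * digit_weight q e j.+1)%N.
    by apply: eq_bigr => j _; rewrite digE.
  rewrite !digsum in E.
  have [||Ea Eb Ef] := mixed_radix_inj q_gt0 leke _ _ (ltdig _) (ltdig _) E => //.
  case: i i' Ea Eb Ef {E} => [[a f] b] [[a' f'] b'] /= Ea Eb Ef.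
  congr (_, _, _); try exact: val_inj.
  by apply/ffunP=> j; apply: val_inj; rewrite /= -!digE Ef.
have root_u z : z \in s -> root (map_poly iota u) z.
  (* It suffices that the [r]-th power of the value vanishes. The [c i] come from [F] and are fixed,
     so this power is the value at [z] of the vanishing combination of the [T i]. *)
  case/sP => fz Nz; rewrite rootE; apply/eqP/(frob_inj (iota := iota) (i := e)).
  rewrite rmorph0.
  have evX n : eval_at z 'X^n = z ^+ n by rewrite /= map_polyXn horner_evalE hornerXn.
  have evB j : (j <= k)%N -> frob e (eval_at z B`_j) = eval_at z H`_j.
    move=> lejk; pose Bz := lin_prod e (fun i => frob i z).
    have evBz : map_poly (eval_at z) B = Bz.
      by rewrite map_lin_prod; apply: eq_lin_prod => i; rewrite evX.
    rewrite -!coef_map evBz.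
    pose Gz := map_poly (eval_at z) (geom_prod k e x).
    have -> : map_poly (eval_at z) H = Gz * map_poly iota gamma.
      rewrite rmorphM /=; congr (_ * _); apply/polyP=> i; rewrite !coef_map /=.
      by rewrite map_polyC horner_evalE hornerC.
    have GB : eq_coefs k (Bz * Gz) 1.
      rewrite -evBz -rmorphM => i leik.
      by rewrite coef_map lin_geom_prod // !coef1; exact: rmorph_nat.
    have -> : map_poly (frob e) Bz = lin_prod e (fun i => frob (e + i)%N z).
      by rewrite map_lin_prod; apply: eq_lin_prod => i; rewrite /= frob_comp.
    (* The factor [1] is replaced by [Bz * Gz]; [Bz] times its Frobenius twist is the full product
       over [e + e] conjugates, equal to [gamma] up to degree [k]. *)
    rewrite -[lin_prod _ _]mul1r.
    have <- : (Bz * Gz * lin_prod e (fun i => frob (e + i)%N z))`_j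
        = (1 * lin_prod e (fun i => frob (e + i)%N z))`_j by apply: eq_coefsM lejk.
    rewrite mulrAC -lin_prod_add mulrC.
    exact: eq_coefsM lejk.
  have evMT i : frob e (eval_at z (M i)) = eval_at z (T i).
    rewrite /M /T !rmorphM !rmorph_prod !evX; congr (_ * _ * _).
    - by rewrite /= frobE -exprM mulnC.
    - by apply: eq_bigr => j _; rewrite !rmorphXn; congr (_ ^+ _); exact: evB.
    - rewrite /= frobE -exprM mulnAC exprM -expnD.
      by have := fz; rewrite frobE => ->.
  have -> : (map_poly iota u).[z] = eval_at z u by [].
  have evT0 : eval_at z (\sum_i c i *: T i) = 0 by rewrite cT rmorph0.
  rewrite -[RHS]evT0 !rmorph_sum; apply: eq_bigr => i _.
  have evZ a (p : {poly F}) : eval_at z (a *: p) = iota a * eval_at z p.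
    by rewrite -mul_polyC rmorphM /= map_polyC !horner_evalE hornerC.
  transitivity (frob e (iota (c i)) * frob e (eval_at z (M i))).
    by rewrite evZ; exact: rmorphM.
  by rewrite frob_iota evMT evZ.
have le_su : (size s < size u)%N.
  rewrite -(size_map_poly iota); apply: max_poly_roots => //; first by rewrite map_poly_eq0.
  by apply/allP.
have le_u : (size u <= (A + k * q * r + r * Bm))%N.
  apply: leq_trans (size_sum _ _ _) _; apply/bigmax_leqP=> i _.
  apply: leq_trans (size_scale_leq _ _) _; rewrite sM -!addSn.
  apply: leq_add; last by rewrite leq_mul // ltnW.
  apply: leq_add; first exact: ltn_ord.
  apply: (sum_digits (fun j => digit_weight q e j.+1)) => j ltj; rewrite ltnW //.
  have [//|] := orP (digit_weight_lt e j.+1 q_gt1).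
  by rewrite ltnS leqNgt (leq_trans ltj leke).
(* Multiplying by [q ^ k] turns [A] into [r], so the main term becomes [r * r = q ^ (e + e)]. *)
apply: leq_trans (leq_mul (ltnW (leq_trans le_su le_u)) (leqnn _)) _.
have -> : ((A + k * q * r + r * Bm) * q ^ k =
   A * q ^ k + r * (A * q ^ k) + q ^ k * (k * q + k * k * q + 2) * r)%N.
  by rewrite /Bm; ring.
by rewrite Dr expnD -/r; apply/eq_leq; ring.
Qed.

End Stepanov.

(** * Newton identities and power sums *)

Section ReversedProducts.
Variable R : idomainType.

Lemma coef_lin_prod_rev e (x : nat -> R) j : (j <= e)%N ->
  (lin_prod e x)`_j = (\prod_(i < e) ('X - (x i)%:P))`_(e - j).
Proof.
have sz d : size (\prod_(i < d) ('X - (x i)%:P)) = d.+1.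
  by rewrite size_prod_XsubC /index_enum -enumT size_enum_ord.
have lc d : (\prod_(i < d) ('X - (x i)%:P))`_d = 1.
  by have := monic_prod_XsubC (index_enum 'I_d) xpredT (fun i => x i);
    rewrite monicE lead_coefE sz => /eqP.
elim: e j => [|e IHe] [|j] lej.
- by rewrite /lin_prod !big_ord0.
- by [].
- by rewrite coef0_lin_prod subn0 lc.
rewrite coef_lin_prodS subSS big_ord_recr /= mulrBr coefB coefMC [X in _ = _ - X]mulrC.
congr (_ - _ * _); last by rewrite IHe.
rewrite coefMX; move: lej; rewrite ltnS leq_eqVlt => /orP[/eqP->|ltje].
  by rewrite subnn coef_lin_prod_gt.
by rewrite subn_eq0 leqNgt ltje /= IHe // subnS.
Qed.

End ReversedProducts.

Section Newton.
Variable R : comNzRingType.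

(** The logarithmic derivative of a product of [1 - x l * 'X] is minus the generating series of the
    power sums. Here it is multiplied out, truncated, and proved one factor at a time. *)
Lemma newton_lin_prod e (x : nat -> R) m :
  eq_coefs m ((lin_prod e x)^`()
    + lin_prod e x * \poly_(i < m.+1) \sum_(l < e) x l ^+ i.+1) 0.
Proof.
elim: e => [|e IHe] j lejm.
  rewrite /lin_prod big_ord0 -[1]/(1%:P) derivC add0r mul1r coef_poly coef0.
  by rewrite ltnS lejm big_ord0.
pose W := \poly_(i < m.+1) \sum_(l < e) x l ^+ i.+1.
pose V := \poly_(i < m.+1) x e ^+ i.+1.
have -> : \poly_(i < m.+1) \sum_(l < e.+1) x l ^+ i.+1 = W + V.
  apply/polyP=> i; rewrite coefD !coef_poly; case: ifP => _; last by rewrite addr0.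
  by rewrite big_ord_recr.
have -> : lin_prod e.+1 x = lin_prod e x * (1 - (x e)%:P * 'X).
  by rewrite /lin_prod big_ord_recr.
set P := lin_prod e x in IHe *; set f := 1 - (x e)%:P * 'X.
have Df : f^`() = - (x e)%:P.
  by rewrite /f derivB -[1]/(1%:P) derivC derivM derivX derivC mul0r !add0r mulr1.
have Vf : eq_coefs m (f * V) (x e)%:P.
  move=> i leim; rewrite /f mulrBl mul1r -mulrA -commr_polyX mulrA coefB coefMX coefCM.
  rewrite coefC !coef_poly ltnS leim; case: i leim => [|i] ltim; first by rewrite subr0.
  by rewrite /= ltnS (ltnW ltim) [x e ^+ i.+2]exprS subrr.
have -> : (P * f)^`() + P * f * (W + V) = f * (P^`() + P * W) + P * (f * V - (x e)%:P).
  by rewrite derivM Df; ring.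
rewrite coefD coef0.
have -> : (f * (P^`() + P * W))`_j = (f * 0)`_j by apply: (eq_coefsM (k := m)).
have -> : (P * (f * V - (x e)%:P))`_j = (P * 0)`_j.
  by apply: (eq_coefsM (k := m)) => // i leim; rewrite coefB Vf // subrr coef0.
by rewrite !mulr0 coef0 addr0.
Qed.

End Newton.

(** [c] lists the coefficients, from the leading one down, of a monic polynomial of degree [D]. The
    negated power sums of its roots obey the same recursion, which determines [S] because
    [c 0 = 1]. *)
Lemma power_sums_of_newton (C : closedFieldType) (c S : nat -> C) D :
    c 0%N = 1 -> (forall j, (D < j)%N -> c j = 0) ->
    (forall j, j.+1%:R * c j.+1 = \sum_(i < j.+1) c i * S (j - i).+1) ->
  exists2 s : seq C, size s = D & forall i, S i.+1 = - \sum_(a <- s) a ^+ i.+1.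
Proof.
move=> c0 cD newtonS; pose p : {poly C} := \poly_(j < D.+1) c (D - j)%N.
have sp : size p = D.+1 by rewrite size_poly_eq // subnn c0 oner_neq0.
have lp : lead_coef p = 1 by rewrite lead_coefE sp coef_poly ltnSn subnn c0.
have [s] := closed_field_poly_normal p; rewrite lp scale1r => Dp.
have ss : size s = D by apply: eq_add_S; rewrite -sp Dp size_prod_XsubC.
exists s => //; pose x i := nth 0 s i.
have Dp' : p = \prod_(i < D) ('X - (x i)%:P) by rewrite Dp (big_nth 0) ss big_mkord.
have cE j : c j = (lin_prod D x)`_j.
  have [lejD|ltDj] := leqP j D.
    by rewrite coef_lin_prod_rev // -Dp' coef_poly ltnS leq_subr subKn.
  by rewrite cD // coef_lin_prod_gt.
elim/ltn_ind => j IHj.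
have := newton_lin_prod D x (leqnn j).
rewrite coefD coef_deriv coefM coef0 -cE -mulr_natl newtonS -big_split /=.
pose psum i := \sum_(a <- s) a ^+ i.
rewrite (eq_bigr (fun i : 'I_j.+1 => c i * (S (j - i).+1 + psum (j - i).+1))); last first.
  move=> i _; rewrite mulrDr cE coef_poly ltnS leq_subr.
  by rewrite /psum (big_nth 0) ss big_mkord.
rewrite big_ord_recl /= subn0 c0 mul1r [X in _ + X]big1 ?addr0 => [|i _].
  by move/eqP; rewrite addr_eq0 => /eqP.
by rewrite IHj ?addNr ?mulr0 // /bump leq0n add1n ltn_subrL; case: (j) i => [[]|].
Qed.

(** * Growth of powers and of power sums *)

Section GeometricGrowth.
Variable C : archiNumFieldType.

(** By Bernoulli's inequality [1 + n * (t - 1) <= t ^ n], the powers are unbounded as soon as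
    [t > 1]. *)
Lemma bounded_powers_le1 (t K : C) n0 :
  0 <= t -> (forall n, (n0 <= n)%N -> t ^+ n <= K) -> t <= 1.
Proof.
move=> t_ge0 tK; have [//|t_gt1] := real_leP (ger0_real t_ge0) (real1 C).
have d_gt0 : 0 < t - 1 by rewrite subr_gt0.
have bern n : 1 + n%:R * (t - 1) <= t ^+ n.
  elim: n => [|n IHn]; first by rewrite mul0r addr0 expr0.
  rewrite exprS; apply: le_trans (ler_wpM2l t_ge0 IHn).
  rewrite -subr_ge0 (_ : _ - _ = n%:R * (t - 1) ^+ 2); last by rewrite -natr1; ring.
  by rewrite mulr_ge0 ?exprn_ge0 // ltW.
have K_ge0 : 0 <= K by apply: le_trans (tK n0 (leqnn _)); rewrite exprn_ge0.
have Kd_ge0 : 0 <= K / (t - 1) by rewrite divr_ge0 // ltW.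
pose n := (n0 + Num.bound (K / (t - 1)))%N.
have := le_trans (bern n) (tK n (leq_addr _ _)).
have : K < n%:R * (t - 1).
  rewrite -ltr_pdivrMr //; apply: lt_le_trans (archi_boundP Kd_ge0) _.
  by rewrite ler_nat leq_addl.
move=> ltK leK; have := lt_le_trans ltK (le_trans _ leK).
by rewrite ltxx lerDr ler01 => /(_ isT).
Qed.

(** A polynomial vanishing at the elements of [s] other than [y] combines consecutive power sums
    into a fixed nonzero multiple of [y ^ n]. Hence the powers of [|y| / Q] are bounded. *)
Lemma power_sum_bound (s : seq C) (Q K : C) n0 : 0 < Q ->
    (forall n, (n0 <= n)%N -> `|\sum_(x <- s) x ^+ n| <= K * Q ^+ n) ->
  forall y, y \in s -> `|y| <= Q.
Proof.
move=> Q_gt0 sumK y sy.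
pose p : {poly C} := \prod_(z <- [seq z <- undup s | z != y]) ('X - z%:P).
have py : p.[y] != 0.
  by rewrite -rootE root_prod_XsubC mem_filter eqxx.
have pz z : z \in s -> z != y -> p.[z] = 0.
  by move=> sz zy; apply/eqP; rewrite -rootE root_prod_XsubC mem_filter zy mem_undup.
pose c := (count_mem y s)%:R * `|p.[y]|.
have c_gt0 : 0 < c.
  by rewrite mulr_gt0 ?normr_gt0 // ltr0n -has_count has_pred1.
have isolate n : \sum_(i < size p) p`_i * \sum_(x <- s) x ^+ (n + i)
    = (count_mem y s)%:R * (y ^+ n * p.[y]).
  under eq_bigr do rewrite big_distrr /=.
  rewrite exchange_big /=.
  rewrite (eq_big_seq (fun x => if x == y then y ^+ n * p.[y] else 0)) => [|x sx].
    by rewrite -big_mkcond big_const_seq iter_addr addr0 mulr_natl.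
  transitivity (x ^+ n * p.[x]).
    rewrite horner_coef big_distrr /=; apply: eq_bigr => i _.
    by rewrite exprD mulrCA.
  by case: eqVneq => [->|/pz->] //; rewrite mulr0.
rewrite -[X in _ <= X]mul1r -ler_pdivrMr //.
pose K' := \sum_(i < size p) `|p`_i| * (K * Q ^+ i).
apply: (@bounded_powers_le1 _ (K' / c) n0); first by rewrite divr_ge0 // ltW.
move=> n le_n; rewrite expr_div_n ler_pdivrMr ?exprn_gt0 // mulrAC ler_pdivlMr //.
have -> : `|y| ^+ n * c = `|\sum_(i < size p) p`_i * \sum_(x <- s) x ^+ (n + i)|.
  by rewrite isolate !normrM normrX normr_nat /c; ring.
apply: le_trans (ler_norm_sum _ _ _) _; rewrite /K' big_distrl /=.
apply: ler_sum => i _; rewrite normrM -!mulrA ler_wpM2l //.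
apply: le_trans (sumK _ _) _; first exact: leq_trans (leq_addr _ _).
by rewrite exprD [Q ^+ n * _]mulrC.
Qed.

End GeometricGrowth.

(** * Sums over monic polynomials *)

Section Monics.
Variable F : finFieldType.

Lemma coef_monic_of n (a : {ffun 'I_n -> F}) (i : 'I_n) : (monic_of a)`_i = a i.
Proof.
rewrite /monic_of coefD coefXn ltn_eqF // add0r coef_sum (bigD1 i) //= big1 => [|j ji].
  by rewrite coefZ coefXn eqxx mulr1 addr0.
by rewrite coefZ coefXn eq_sym (inj_eq val_inj) (negPf ji) mulr0.
Qed.

Lemma size_monic_low n (a : {ffun 'I_n -> F}) :
  (size (\sum_(i < n) a i *: 'X^i)%R < n.+1)%N.
Proof.
rewrite ltnS; apply: leq_trans (size_sum _ _ _) _; apply/bigmax_leqP=> i _.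
by apply: leq_trans (size_scale_leq _ _) _; rewrite size_polyXn.
Qed.

Lemma size_monic_of n (a : {ffun 'I_n -> F}) : size (monic_of a) = n.+1.
Proof. by rewrite size_polyDl size_polyXn // size_monic_low. Qed.

Lemma monic_of_monic n (a : {ffun 'I_n -> F}) : monic_of a \is monic.
Proof. by rewrite monicE lead_coefDl ?lead_coefXn // size_polyXn size_monic_low. Qed.

Lemma monic_of_inj n : injective (@monic_of F n).
Proof. by move=> a b E; apply/ffunP=> i; rewrite -!coef_monic_of E. Qed.

Lemma monic_of_coefs n (f : {poly F}) : f \is monic -> size f = n.+1 ->
  monic_of [ffun i : 'I_n => f`_i] = f.
Proof.
move=> mf sf; apply/polyP=> i; have [lti|] := ltnP i n.
  by rewrite (coef_monic_of _ (Ordinal lti)) ffunE.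
rewrite leq_eqVlt => /orP[/eqP <-|lti].
  rewrite -{1}(size_monic_of [ffun i : 'I_n => f`_i]) in sf *.
  have := monic_of_monic [ffun i : 'I_n => f`_i].
  rewrite monicE lead_coefE size_monic_of => /eqP ->.
  by move: mf; rewrite monicE lead_coefE sf size_monic_of => /eqP.
by rewrite !nth_default ?size_monic_of ?sf.
Qed.

Definition monics (n : nat) : seq {poly F} := [seq monic_of a | a : {ffun 'I_n -> F}].

Lemma monics_uniq n : uniq (monics n).
Proof. by rewrite map_inj_uniq ?enum_uniq //; apply: monic_of_inj. Qed.

Lemma mem_monics n f : (f \in monics n) = (f \is monic) && (size f == n.+1).
Proof.
apply/mapP/andP=> [[a _ ->]|[mf /eqP sf]].
  by rewrite monic_of_monic size_monic_of eqxx.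
by exists [ffun i : 'I_n => f`_i]; rewrite ?mem_enum // monic_of_coefs.
Qed.

Lemma big_monics (R : nmodType) n (G : {poly F} -> R) :
  \sum_(f <- monics n) G f = \sum_(a : {ffun 'I_n -> F}) G (monic_of a).
Proof. by rewrite big_map big_enum. Qed.

Lemma size_mul_monic (f g : {poly F}) m n : f \is monic -> size f = m.+1 ->
  size g = n.+1 -> size (f * g) = (m + n).+1.
Proof.
move=> mf sf sg; rewrite size_monicM //; first by rewrite sf sg addSn addnS.
by rewrite -size_poly_gt0 sg.
Qed.

Lemma monic_cofactor (f g : {poly F}) : f \is monic -> g \is monic -> g %| f ->
  exists2 h, h \is monic & f = g * h.
Proof.
move=> mf mg gf; exists (f %/ g); last by rewrite mulrC divpK.
by move: mf; rewrite -{1}(divpK gf) monicMr.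
Qed.

Lemma perm_monics_multiples (N : {poly F}) d n : N \is monic -> size N = d.+1 ->
  perm_eq [seq f <- monics (d + n) | N %| f] [seq N * g | g <- monics n].
Proof.
move=> mN sN; have nzN : N != 0 by rewrite -size_poly_gt0 sN.
apply: uniq_perm; first by rewrite filter_uniq ?monics_uniq.
  by rewrite map_inj_uniq ?monics_uniq //; apply: mulfI.
move=> f; rewrite mem_filter mem_monics; apply/idP/mapP.
  case/and3P=> Nf mf /eqP sf; have [g mg Df] := monic_cofactor mf mN Nf.
  exists g => //; rewrite mem_monics mg /=.
  have := sf; rewrite Df size_monicM ?monic_neq0 // sN addSn /= -addnS.
  by move/addnI => ->.
case=> g; rewrite mem_monics => /andP[mg /eqP sg] ->.
by rewrite dvdp_mulr // monicMl // mg /= (size_mul_monic mN sN sg) eqxx.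
Qed.

End Monics.

Lemma root_dvdp (K : fieldType) (p f : {poly K}) z : p %| f -> root p z -> root f z.
Proof. by rewrite -!dvdp_XsubCl => pf zp; apply: dvdp_trans pf. Qed.

(** * Newton identities for multiplicative functions of monic polynomials *)

Section NewtonCounting.
Variables (F : finFieldType) (L : closedFieldType) (iota : {rmorphism F -> L}).
Local Notation q := #|F|.
Local Notation frob := (frob iota).
Local Notation charp := (frob_charpoly iota).

Lemma frob_charpolyD d i z : frob d z = z -> charp (d + i) z = charp d z * charp i z.
Proof.
move=> fz; rewrite /frob_charpoly big_split_ord /=; congr (_ * _).
by apply: eq_bigr => j _; rewrite addnC -frob_comp fz.
Qed.

Lemma root_frob_charpoly d z : (0 < d)%N -> root (charp d z) z.
Proof.
case: d => // d _; rewrite /frob_charpoly big_ord_recl frob0 /= rootM.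
by rewrite root_XsubC eqxx.
Qed.

Lemma frob_charpolyE d z : charp d z = \prod_(x <- mkseq (frob^~ z) d) ('X - x%:P).
Proof. by rewrite /mkseq big_map -[d in RHS]subn0 -/(index_iota 0 d) big_mkord. Qed.

Lemma root_frob (f : {poly F}) i z :
  root (map_poly iota f) z -> root (map_poly iota f) (frob i z).
Proof. by rewrite !rootE -horner_frob => /eqP ->; rewrite rmorph0. Qed.

Lemma frob_eq_fix i j z : (i < j)%N -> frob i z = frob j z -> frob (j - i) z = z.
Proof.
move=> ltij E; apply: (frob_inj (iota := iota) (i := i)).
by rewrite frob_comp subnKC ?E // ltnW.
Qed.

(** The Frobenius orbit of a root consists of roots, hence is finite and has a least period [d]. The
    first [d] conjugates are distinct roots, so the product of their linear factors divides [f]. *)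
Lemma root_period (f : {poly F}) z : f != 0 -> root (map_poly iota f) z ->
  exists d, [/\ (0 < d)%N, frob d z = z, charp d z %| map_poly iota f
    & forall i, (0 < i < d)%N -> frob i z <> z].
Proof.
move=> nzf rz; have nzfL : map_poly iota f != 0 by rewrite map_poly_eq0.
have ex_d : exists d, (0 < d)%N && (frob d z == z).
  pose s := mkseq (frob^~ z) (size f).
  have : ~~ uniq s.
    apply/negP=> us; have := max_poly_roots nzfL _ us.
    rewrite size_map_poly size_mkseq ltnn => /(_ _)/negP; apply; last by [].
    by apply/allP=> _ /mapP[i _ ->]; apply: root_frob.
  case/(uniqPn 0) => i [j [ltij]]; rewrite size_mkseq => ltj.
  rewrite !nth_mkseq ?(ltn_trans ltij) // => E.
  by exists (j - i)%N; rewrite subn_gt0 ltij (frob_eq_fix ltij E) eqxx.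
case: (ex_minnP ex_d) => d /andP[d_gt0 /eqP fd] mind; exists d.
have minP i : (0 < i < d)%N -> frob i z <> z.
  case/andP=> i_gt0 ltid fi; have := mind i; rewrite i_gt0 fi eqxx leqNgt ltid.
  by move/(_ isT).
split=> //; rewrite frob_charpolyE; apply: uniq_roots_dvdp.
  by apply/allP=> _ /mapP[i _ ->]; apply: root_frob.
rewrite uniq_rootsE; apply/mkseq_uniqP=> i j; rewrite !inE => ltid ltjd E.
have [lt|lt|//] := ltngtP i j.
  case: (minP (j - i)%N); last exact: frob_eq_fix.
  by rewrite subn_gt0 lt (leq_ltn_trans (leq_subr _ _)).
case: (minP (i - j)%N); last by apply: frob_eq_fix.
by rewrite subn_gt0 lt (leq_ltn_trans (leq_subr _ _)).
Qed.

(** If [z] is a root, only multiples [d * t] of its least period count, and there [charp] is the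
    [t]-th power of the minimal polynomial. The index [0] gives the extra one. The induction divides
    [f] by one copy of the minimal polynomial. *)
Lemma count_charpoly_divisors m (f : {poly F}) (s : seq L) z :
    f \is monic -> size f = m.+1 -> map_poly iota f = \prod_(x <- s) ('X - x%:P) ->
  (\sum_(i < m.+1) ((frob i z == z) && (charp i z %| map_poly iota f)%R)
     = (count_mem z s).+1)%N.
Proof.
elim/ltn_ind: m f s => m IHm f s mf sf Df.
have [rz|nrz] := boolP (root (map_poly iota f) z); last first.
  rewrite big_ord_recl frob0 eqxx /frob_charpoly big_ord0 dvd1p big1 => [|i _].
    by rewrite (count_memPn _) // -root_prod_XsubC -Df.
  apply/eqP; rewrite eqb0 negb_and; apply/orP; right.
  by apply: contra nrz => /root_dvdp; apply; apply: root_frob_charpoly.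
have [d [d_gt0 fd df mind]] := root_period (monic_neq0 mf) rz.
pose N := charpoly_over iota d z.
have NL : map_poly iota N = charp d z by apply: map_charpoly_over.
have mN : N \is monic by apply: charpoly_over_monic.
have sN : size N = d.+1 by apply: size_charpoly_over.
have Nf : N %| f by rewrite -(dvdp_map iota) NL.
have [g mg Dfg] := monic_cofactor mf mN Nf.
have [t sg] : exists t, size g = t.+1.
  by exists (size g).-1; rewrite prednK // size_poly_gt0 monic_neq0.
have Dm : m = (d + t)%N.
  by apply: eq_add_S; rewrite -sf Dfg (size_mul_monic mN sN sg).
have [s'] := closed_field_poly_normal (map_poly iota g).
rewrite lead_coef_map (monicP mg) rmorph1 scale1r => Dg.
have perm_s : perm_eq s (mkseq (frob^~ z) d ++ s').
  by apply: prod_XsubC_eq; rewrite big_cat /= -frob_charpolyE -Dg -NL -Df Dfg rmorphM.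
have cz : count_mem z s = (count_mem z s').+1.
  rewrite (seq.permP perm_s) count_cat -addn1 addnC; congr (_ + _)%N.
  rewrite /mkseq count_map; case: (d) d_gt0 mind => // d' _ mind /=.
  rewrite frob0 eqxx -[1%N]addn0; congr (_ + _)%N; apply/eqP.
  rewrite -leqn0 leqNgt -has_count; apply/hasPn=> i.
  rewrite mem_iota add1n => lti /=; apply/eqP; exact: mind.
(* The sum is split at [d]: below, only the index [0] contributes; from [d] on, the terms are those
   of the cofactor [g]. *)
rewrite cz Dm -addnS big_split_ord /=.
rewrite (bigD1 (Ordinal d_gt0)) //= frob0 eqxx /frob_charpoly big_ord0 dvd1p.
rewrite big1 ?addn0 => [|i i0]; last first.
  apply/eqP; rewrite eqb0 negb_and; apply/orP; left; apply/eqP/mind.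
  by rewrite ltn_ord andbT lt0n.
rewrite -(IHm t _ g s' mg sg Dg) ?Dm ?ltnNge -?ltnNge; last first.
  by rewrite -[X in (X < _)%N]add0n ltn_add2r.
rewrite add1n; congr _.+1; apply: eq_bigr => i _.
rewrite -/(charp _ _) frob_charpolyD // addnC -frob_comp fd.
by rewrite Dfg rmorphM /= NL dvdp_mul2l // monic_neq0 // frob_charpoly_monic.
Qed.

(** The list is empty for [d = 0], where every point of [L] would be fixed. *)
Definition frob_points (d : nat) : seq L :=
  if d is d'.+1 then sval (frob_points_exist iota (ltn0Sn d')) else [::].

Lemma frob_points_uniq d : uniq (frob_points d).
Proof. by case: d => //= d; case: frob_points_exist => s []. Qed.

Lemma size_frob_points d : (0 < d)%N -> size (frob_points d) = (q ^ d)%N.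
Proof. by case: d => //= d _; case: frob_points_exist => s []. Qed.

Lemma mem_frob_points d z : (0 < d)%N -> (z \in frob_points d) = (frob d z == z).
Proof. by case: d => //= d _; case: frob_points_exist => s /= [_ _ ->]. Qed.

(** Dropping the index [0] from [count_charpoly_divisors] leaves the multiplicity of each root, and
    the multiplicities add up to the degree. *)
Lemma count_charpoly_over m (f : {poly F}) : f \is monic -> size f = m.+1 ->
  (\sum_(i < m) count (fun z => charpoly_over iota i.+1 z %| f)%R (frob_points i.+1) = m)%N.
Proof.
move=> mf sf; have [s] := closed_field_poly_normal (map_poly iota f).
rewrite lead_coef_map (monicP mf) rmorph1 scale1r => Df.
have ss : size s = m by apply: eq_add_S; rewrite -(size_prod_XsubC s id) -Df size_map_poly.
transitivity (\sum_(i < m) \sum_(z <- undup s)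
    ((frob i.+1 z == z) && (charp i.+1 z %| map_poly iota f)%R))%N.
  apply: eq_bigr => i _; rewrite -big_mkcond sum1_count -!size_filter.
  apply/perm_size/uniq_perm; rewrite ?filter_uniq ?undup_uniq ?frob_points_uniq //.
  move=> z; rewrite !mem_filter mem_undup mem_frob_points // andbC -andbA.
  case: eqP => //= fz; rewrite -(dvdp_map iota) map_charpoly_over //.
  case: (boolP (_ %| _)) => //= dv; rewrite -root_prod_XsubC -Df.
  by rewrite (root_dvdp dv) // root_frob_charpoly.
rewrite exchange_big /= -[RHS]ss.
transitivity (\sum_(z <- undup s) count_mem z s)%N.
  apply: eq_bigr => z _; have := count_charpoly_divisors z mf sf Df.
  by rewrite big_ord_recl frob0 eqxx /frob_charpoly big_ord0 dvd1p add1n => -[].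
rewrite -sum1_size -(big_undup_iterop_count addn s xpredT (fun=> 1%N)).
by apply: eq_bigr => z _; rewrite Monoid.iteropE; elim: (count_mem z s) => //= n <-.
Qed.

Variables (R : comNzRingType) (X : {poly F} -> R).
Hypothesis XM : forall f g, f \is monic -> g \is monic -> X (f * g) = X f * X g.

Definition point_sum (d : nat) : R := \sum_(z <- frob_points d) X (charpoly_over iota d z).

(** The factor [m.+1] is the degree of [f], which counts the points whose characteristic polynomial
    [N] divides [f]; writing [f = N * g] separates the sum. This is the logarithmic derivative of
    the L-series of [X], coefficient by coefficient. *)
Lemma newton_monic_sums m :
  m.+1%:R * \sum_(f <- monics F m.+1) X f
    = \sum_(i < m.+1) (\sum_(f <- monics F i) X f) * point_sum (m - i).+1.
Proof.
transitivity (\sum_(f <- monics F m.+1) \sum_(i < m.+1) \sum_(z <- frob_points i.+1)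
    (charpoly_over iota i.+1 z %| f)%R%:R * X f).
  rewrite big_distrr /=; apply: eq_big_seq => f; rewrite mem_monics => /andP[mf /eqP sf].
  rewrite -{1}(count_charpoly_over mf sf) natr_sum big_distrl /=.
  apply: eq_bigr => i _; rewrite -big_distrl /=; congr (_ * _).
  by rewrite -sum1_count natr_sum big_mkcond; apply: eq_bigr => z _; case: ifP.
rewrite exchange_big /= (reindex_inj rev_ord_inj) /=; apply: eq_bigr => i _.
rewrite subSS exchange_big /= mulrC /point_sum big_distrl /=.
apply: eq_big_seq => z; rewrite -/(frob_points (m - i).+1) mem_frob_points // => /eqP fz.
set N := charpoly_over _ _ _.
have mN : N \is monic by apply: charpoly_over_monic.
have sN : size N = (m - i).+2 by apply: size_charpoly_over.
transitivity (\sum_(f <- [seq f <- monics F m.+1 | N %| f]) X f).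
  by rewrite big_filter [RHS]big_mkcond; apply: eq_bigr => f _; case: ifP; rewrite ?mul1r ?mul0r.
have Dm : ((m - i).+1 + i = m.+1)%N by rewrite addSn subnK // -ltnS.
have := perm_monics_multiples i mN sN; rewrite Dm => perm_N.
rewrite (perm_big _ perm_N) big_map big_distrr /=.
by apply: eq_big_seq => g; rewrite mem_monics => /andP[mg _]; rewrite XM.
Qed.

End NewtonCounting.

(** * The group of unipotent classes *)

Section FiniteFunctionRestriction.
Variables (F : finZmodType) (n k : nat) (h : 'I_k -> 'I_n).
Hypothesis h_inj : injective h.

Let restr (a : {ffun 'I_n -> F}) : {ffun 'I_k -> F} := [ffun j => a (h j)].

(** Translation by an extension of [w] carries the fibre over [0] to the fibre over [w], so all
    fibres have the same size. *)
Lemma card_restriction_fiber v : #|[pred a | restr a == v]| = (#|F| ^ (n - k))%N.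
Proof.
pose ext (v : {ffun 'I_k -> F}) : {ffun 'I_n -> F} :=
  [ffun i => if [pick j | h j == i] is Some j then v j else 0].
have restrD a b : restr (a + b) = restr a + restr b by apply/ffunP=> j; rewrite !ffunE.
have extK w : restr (ext w) = w.
  apply/ffunP=> j; rewrite !ffunE; case: pickP => [j' /eqP/h_inj -> //|/(_ j)].
  by rewrite eqxx.
have fiber0 w : #|[pred a | restr a == w]| = #|[pred a | restr a == 0]|.
  have addK : injective (fun a : {ffun 'I_n -> F} => a + ext w) by apply: addIr.
  rewrite -[RHS](card_image addK); apply: eq_card => a; rewrite [LHS]inE; apply/eqP/imageP.
    move=> ra; exists (a - ext w); last by rewrite subrK.
    have := restrD (a - ext w) (ext w); rewrite subrK ra extK inE => E.
    by apply/eqP; apply: (addIr w); rewrite -E add0r.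
  by case=> b; rewrite inE => /eqP rb ->; rewrite restrD rb extK add0r.
have lekn : (k <= n)%N by have := leq_card h h_inj; rewrite !card_ord.
have F_gt0 : (0 < #|F|)%N by apply/card_gt0P; exists 0.
have : (#|{ffun 'I_n -> F}| = #|[pred a | restr a == 0%R]| * #|{ffun 'I_k -> F}|)%N.
  rewrite -[LHS]sum1_card (partition_big restr xpredT) //=.
  rewrite (eq_bigr (fun _ => #|[pred a | restr a == 0]|)) => [|w _].
    by rewrite sum_nat_const mulnC.
  by rewrite sum1_card fiber0.
rewrite !card_ffun !card_ord -{1}(subnK lekn) expnD fiber0 => /eqP.
by rewrite eqn_pmul2r ?expn_gt0 ?F_gt0 // => /eqP.
Qed.

Lemma sum_restriction (R : pzRingType) (G : {ffun 'I_k -> F} -> R) :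
  \sum_(a : {ffun 'I_n -> F}) G (restr a) = (#|F| ^ (n - k))%:R * \sum_v G v.
Proof.
rewrite (partition_big restr xpredT) //= big_distrr /=; apply: eq_bigr => v _.
rewrite (eq_bigr (fun _ => G v)) => [|a /eqP -> //].
by rewrite sumr_const card_restriction_fiber mulr_natl.
Qed.

End FiniteFunctionRestriction.

Section UnipotentClasses.
Variables (F : finFieldType) (k : nat).
Local Notation q := #|F|.

Implicit Types (p : {poly F}).

(** Multiplication by [p] modulo ['X^k.+1] as an upper triangular matrix. The classes thus lie in
    the finite group of invertible matrices, where character theory is available. *)
Definition toeplitz (p : {poly F}) : 'M[F]_k.+1 :=
  \matrix_(i, j) if (i <= j)%N then p`_(j - i) else 0.

Lemma toeplitzM p p' : toeplitz (p * p') = toeplitz p *m toeplitz p'.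
Proof.
apply/matrixP=> i j; rewrite !mxE; case: leqP => [leij|ltji]; last first.
  rewrite big1 // => l _; rewrite !mxE; case: leqP; rewrite ?mul0r // => leil.
  by rewrite leqNgt (leq_trans ltji leil) mulr0.
rewrite coefM -(big_mkord xpredT (fun l => p`_l * p'`_(j - i - l))) -subSn //.
have -> : \sum_(0 <= l < j.+1 - i) p`_l * p'`_(j - i - l)
    = \sum_(i <= l < j.+1) p`_(l - i) * p'`_(j - l).
  rewrite -[X in _ = \sum_(X <= _ < _) _]add0n big_addn; apply: eq_bigr => l _.
  by rewrite addnK addnC subnDA.
rewrite (big_nat_widenl _ 0) // (big_nat_widen _ _ k.+1) //= big_mkord big_mkcond /=.
apply: eq_bigr => l _; rewrite !mxE ltnS; case: leqP; rewrite ?mul0r //= => _.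
by case: leqP; rewrite ?mulr0.
Qed.

Lemma toeplitz1 : toeplitz 1 = 1%:M.
Proof.
apply/matrixP=> i j; rewrite !mxE coef1 subn_eq0 -(inj_eq val_inj) eqn_leq.
by case: (i <= j)%N.
Qed.

Lemma toeplitz_eq p p' : toeplitz p = toeplitz p' <-> eq_coefs k p p'.
Proof.
split=> [/matrixP E j lejk|E].
  by have := E ord0 (Ordinal (lejk : j < k.+1)%N); rewrite !mxE /= subn0.
apply/matrixP=> i j; rewrite !mxE; case: ifP => // _; apply: E.
by rewrite (leq_trans (leq_subr _ _)) // -ltnS.
Qed.

Lemma toeplitz_unit p : p`_0 = 1 -> toeplitz p \is a GRing.unit.
Proof.
move=> p0; change (toeplitz p \in unitmx); rewrite unitmxE -det_tr det_trig.
  by rewrite big1 ?unitr1 // => i _; rewrite !mxE leqnn subnn.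
by apply/is_trig_mxP => i j ltij; rewrite !mxE leqNgt ltij.
Qed.

Local Notation gT := {unit 'M[F]_k.+1}.

(** The default [1] is taken when the matrix is not invertible; the intended arguments have constant
    coefficient [1]. *)
Definition unipotent (p : {poly F}) : gT := insubd (1%g : gT) (toeplitz p).

Lemma val_unipotent p : p`_0 = 1 -> val (unipotent p) = toeplitz p.
Proof. by move=> p0; rewrite val_insubd toeplitz_unit. Qed.

Lemma unipotentM p p' : p`_0 = 1 -> p'`_0 = 1 ->
  unipotent (p * p') = (unipotent p * unipotent p')%g.
Proof.
move=> p0 p'0; apply: val_inj; rewrite FinRing.val_unitM !val_unipotent ?toeplitzM //.
by rewrite coefM big_ord_recl big_ord0 addr0 p0 p'0 mulr1.
Qed.

Lemma unipotent_eq p p' : p`_0 = 1 -> p'`_0 = 1 ->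
  unipotent p = unipotent p' <-> eq_coefs k p p'.
Proof.
move=> p0 p'0; rewrite -toeplitz_eq -!val_unipotent //.
by split=> [-> //|/val_inj].
Qed.

Definition one_plus (v : {ffun 'I_k -> F}) : {poly F} :=
  1 + \sum_(j < k) v j *: 'X^(j.+1).

Lemma coef0_one_plus v : (one_plus v)`_0 = 1.
Proof.
rewrite coefD coef1 coef_sum big1 ?addr0 // => j _.
by rewrite coefZ coefXn mulr0.
Qed.

Lemma coefS_one_plus v (j : 'I_k) : (one_plus v)`_j.+1 = v j.
Proof.
rewrite coefD coef1 add0r coef_sum (bigD1 j) //= coefZ coefXn eqxx mulr1.
rewrite big1 ?addr0 // => i ij.
by rewrite coefZ coefXn eqSS eq_sym (inj_eq val_inj) (negPf ij) mulr0.
Qed.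

Lemma one_plus_coefs p : p`_0 = 1 -> eq_coefs k (one_plus [ffun j : 'I_k => p`_j.+1]) p.
Proof.
move=> p0 [|j] lejk; first by rewrite coef0_one_plus.
by rewrite (coefS_one_plus _ (Ordinal lejk)) ffunE.
Qed.

Definition unipotent_set : {set gT} := [set unipotent (one_plus v) | v : {ffun 'I_k -> F}].

Lemma mem_unipotent p : p`_0 = 1 -> unipotent p \in unipotent_set.
Proof.
move=> p0; apply/imsetP; exists [ffun j : 'I_k => p`_j.+1]; rewrite ?inE //.
by apply/esym/unipotent_eq; rewrite ?coef0_one_plus //; apply: one_plus_coefs.
Qed.

Lemma unipotent_group_set : group_set unipotent_set.
Proof.
apply/group_setP; split=> [|_ _ /imsetP[v _ ->] /imsetP[w _ ->]].
  suff <- : unipotent 1 = 1%g by rewrite mem_unipotent // coef1.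
  by apply: val_inj; rewrite val_unipotent ?coef1 // toeplitz1.
rewrite -unipotentM ?coef0_one_plus // mem_unipotent //.
by rewrite coefM big_ord_recl big_ord0 addr0 !coef0_one_plus mulr1.
Qed.

Canonical unipotent_group := Group unipotent_group_set.

Lemma unipotent_abelian : abelian unipotent_set.
Proof.
apply/centsP=> _ /imsetP[v _ ->] _ /imsetP[w _ ->].
by rewrite /commute -!unipotentM ?coef0_one_plus // mulrC.
Qed.

Lemma unipotent_one_plus_inj : injective (fun v => unipotent (one_plus v)).
Proof.
move=> v w /unipotent_eq E; apply/ffunP=> j; rewrite -!coefS_one_plus.
by rewrite E ?coef0_one_plus // ltn_ord.
Qed.

Lemma card_unipotent : #|unipotent_set| = (q ^ k)%N.
Proof.
by rewrite card_imset ?card_ffun ?card_ord //; apply: unipotent_one_plus_inj.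
Qed.

End UnipotentClasses.

(** * Character sums *)

Section Classes.
Variables (F : finFieldType) (L : closedFieldType) (iota : {rmorphism F -> L}) (k : nat).
Local Notation q := #|F|.
Local Notation frob := (frob iota).
Implicit Types (f g : {poly F}).

(* [x ^ deg f * f (1 / x)] modulo [x ^ (k + 1)]. *)
Definition rev_coefs f : {poly F} :=
  \poly_(i < k.+1) if (i < size f)%N then f`_((size f).-1 - i) else 0.

(** Reversal turns each factor ['X - x] into [1 - x * 'X]. Multiplicativity of classes then follows
    by concatenating lists of roots. *)
Lemma rev_coefs_roots f (s : seq L) : map_poly iota f = \prod_(x <- s) ('X - x%:P) ->
  eq_coefs k (map_poly iota (rev_coefs f)) (\prod_(x <- s) (1 - x%:P * 'X)).
Proof.
move=> Df j lejk.
have sf : size f = (size s).+1 by rewrite -(size_map_poly iota) Df size_prod_XsubC.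
have -> : \prod_(x <- s) (1 - x%:P * 'X) = lin_prod (size s) (nth 0 s).
  by rewrite (big_nth 0) big_mkord.
rewrite coef_map coef_poly ltnS lejk sf ltnS /=; case: leqP => [lejs|ltsj].
  by rewrite coef_lin_prod_rev // -coef_map Df (big_nth 0) big_mkord.
by rewrite rmorph0 coef_lin_prod_gt.
Qed.

Lemma monic_roots f : f \is monic ->
  exists s : seq L, map_poly iota f = \prod_(x <- s) ('X - x%:P).
Proof.
move=> mf; have [s] := closed_field_poly_normal (map_poly iota f).
by rewrite lead_coef_map (monicP mf) rmorph1 scale1r; exists s.
Qed.

Lemma eq_coefs_map f g : eq_coefs k (map_poly iota f) (map_poly iota g) -> eq_coefs k f g.
Proof. by move=> E j lejk; apply: (fmorph_inj iota); rewrite -!coef_map E. Qed.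

Lemma rev_coefsM f g : f \is monic -> g \is monic ->
  eq_coefs k (rev_coefs (f * g)) (rev_coefs f * rev_coefs g).
Proof.
move=> /monic_roots[s Ds] /monic_roots[t Dt]; apply: eq_coefs_map.
have Dst : map_poly iota (f * g) = \prod_(x <- s ++ t) ('X - x%:P).
  by rewrite rmorphM /= Ds Dt big_cat.
move=> j lejk; rewrite (rev_coefs_roots Dst) // big_cat rmorphM /=.
by apply: (eq_coefsM (k := k)) lejk => i leik; rewrite ?(rev_coefs_roots Ds) ?(rev_coefs_roots Dt).
Qed.

Lemma coef0_rev_coefs f : f \is monic -> (rev_coefs f)`_0 = 1.
Proof.
move=> mf; rewrite coef_poly /= subn0 -lead_coefE (monicP mf).
by rewrite size_poly_gt0 monic_neq0.
Qed.

Definition class_of f := unipotent k (rev_coefs f).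

Lemma class_of_in f : f \is monic -> class_of f \in unipotent_group F k.
Proof. by move=> mf; rewrite mem_unipotent // coef0_rev_coefs. Qed.

Lemma class_ofM f g : f \is monic -> g \is monic ->
  class_of (f * g) = (class_of f * class_of g)%g.
Proof.
move=> mf mg; rewrite /class_of -unipotentM ?coef0_rev_coefs //.
apply/unipotent_eq; rewrite ?coef0_rev_coefs ?monicMl //; last exact: rev_coefsM.
by rewrite coefM big_ord_recl big_ord0 addr0 !coef0_rev_coefs // mulr1.
Qed.

Lemma class_of1 : class_of 1 = 1%g.
Proof.
have := class_ofM (monic1 F) (monic1 F); rewrite mulr1 => E.
by apply: (mulgI (class_of 1)); rewrite -E mulg1.
Qed.

(** Translates a condition on the class of [z] into the congruence assumed in [stepanov_bound]. *)
Lemma class_of_charpoly d z (p : {poly F}) : frob d z = z -> p`_0 = 1 ->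
  class_of (charpoly_over iota d z) = unipotent k p ->
  eq_coefs k (lin_prod d (frob^~ z)) (map_poly iota p).
Proof.
move=> fz p0 /unipotent_eq; rewrite coef0_rev_coefs ?charpoly_over_monic // => E.
have := @rev_coefs_roots (charpoly_over iota d z) (mkseq (frob^~ z) d).
rewrite map_charpoly_over // frob_charpolyE => /(_ erefl) R j lejk.
have -> : lin_prod d (frob^~ z) = \prod_(x <- mkseq (frob^~ z) d) (1 - x%:P * 'X).
  by rewrite /mkseq big_map -[d in RHS]subn0 -/(index_iota 0 d) big_mkord.
by rewrite -R // !coef_map E.
Qed.

Section MonicClasses.
Variables (n : nat) (lekn : (k <= n)%N).

Definition top_index (j : 'I_k) : 'I_n := rev_ord (widen_ord lekn j).

Lemma top_index_inj : injective top_index.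
Proof. by move=> i j /rev_ord_inj /(congr1 val) /= E; apply: val_inj. Qed.

Lemma class_monic_of (a : {ffun 'I_n -> F}) :
  class_of (monic_of a) = unipotent k (one_plus [ffun j => a (top_index j)]).
Proof.
apply/unipotent_eq; rewrite ?coef0_one_plus ?coef0_rev_coefs ?monic_of_monic //.
case=> [|j] lejk.
  by rewrite coef0_rev_coefs ?monic_of_monic ?coef0_one_plus.
rewrite (coefS_one_plus _ (Ordinal lejk)) ffunE coef_poly ltnS lejk size_monic_of.
by rewrite ltnS (leq_trans lejk lekn) /= -coef_monic_of.
Qed.

(** The class amounts to the [k] coefficients just below the leading one; the other [n - k] are
    free. *)
Lemma sum_class_monics (R : pzRingType) (G : {unit 'M[F]_k.+1} -> R) :
  \sum_(f <- monics F n) G (class_of f)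
    = (q ^ (n - k))%:R * \sum_(x in unipotent_group F k) G x.
Proof.
rewrite big_monics; under eq_bigr do rewrite class_monic_of.
rewrite (sum_restriction top_index_inj (fun v => G (unipotent k (one_plus v)))).
by rewrite big_imset //= => v w _ _; apply: unipotent_one_plus_inj.
Qed.

End MonicClasses.

End Classes.

Lemma sum_irr_neq0 (gT : finGroupType) (G : {group gT}) (i : Iirr G) : i != 0 ->
  \sum_(x in G) 'chi_i x = 0.
Proof.
move=> i0; have := cfdot_irr i 0; rewrite (negPf i0) irr0 cfdotE => /eqP.
rewrite mulf_eq0 invr_eq0 (negPf (neq0CG G)) /= => /eqP E; rewrite -[RHS]E.
by apply: eq_bigr => x Gx; rewrite cfun1E Gx rmorph1 mulr1.
Qed.

(** * Weil's bound for the sums over points *)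

Section CharacterSums.
Variables (F : finFieldType) (L : closedFieldType) (iota : {rmorphism F -> L}) (k : nat).
Local Notation q := #|F|.
Local Notation frob := (frob iota).
Local Notation G := (unipotent_group F k).
Variable i : Iirr G.

Lemma irr_unipotent_lin : 'chi_i \is a linear_char.
Proof. by have /char_abelianP/(_ i) := unipotent_abelian F k. Qed.

Definition class_char (f : {poly F}) : algC := 'chi_i (class_of k f).

Lemma class_charM f g : f \is monic -> g \is monic ->
  class_char (f * g) = class_char f * class_char g.
Proof.
move=> mf mg; rewrite /class_char (class_ofM iota) //.
by rewrite (lin_charM irr_unipotent_lin) ?class_of_in.
Qed.

Local Notation S d := (point_sum iota class_char d).

Hypothesis i_neq0 : i != 0.

(** Stepanov's method bounds each count [N g] only from above, by some [T]. As the character sums to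
    zero over [G], the sum is also [- \sum_g (T - N g) chi(g)], and the nonnegative weights
    [T - N g] add up to [C * q ^ e]. *)
Lemma point_sum_double_bound e : (k <= e)%N -> (k * k * q + 2 < q ^ e)%N ->
  `|S (e + e)| <= (1 + q ^ k * (k * q + k * k * q + 2))%:R * q%:R ^+ e.
Proof.
move=> leke big_e; set C := (1 + _)%N.
have e_gt0 : (0 < e)%N.
  by case: (e) big_e => //; rewrite expn0 addn2 ltnS ltn0.
pose pts := frob_points iota (e + e).
have pts_gt0 : (0 < e + e)%N by rewrite addn_gt0 e_gt0.
pose cls z := class_of k (charpoly_over iota (e + e) z).
pose N g := count (fun z => cls z == g) pts.
have cls_in z : z \in pts -> cls z \in G.
  by rewrite mem_frob_points // => /eqP fz; rewrite class_of_in ?charpoly_over_monic.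
have boundN g : g \in G -> (N g * q ^ k <= q ^ (e + e) + C * q ^ e)%N.
  case/imsetP=> v _ Dg; rewrite /N -size_filter.
  apply: (stepanov_bound (iota := iota) (gamma := one_plus v)) => //.
    by rewrite filter_uniq ?frob_points_uniq.
  move=> z; rewrite mem_filter mem_frob_points // => /andP[/eqP cz /eqP fz].
  by split=> //; apply: class_of_charpoly; rewrite ?coef0_one_plus // -Dg.
have sumN (f : {unit 'M[F]_k.+1} -> algC) :
    \sum_(z <- pts) f (cls z) = \sum_(g in G) (N g)%:R * f g.
  rewrite (eq_big_seq (fun z => \sum_(g in G) (cls z == g)%:R * f g)) => [|z /cls_in Gz].
    rewrite exchange_big /=; apply: eq_bigr => g _.
    rewrite -big_distrl /= -natr_sum /N -sum1_count [in RHS]big_mkcond /=.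
    by congr (_%:R * _); apply: eq_bigr => z _; case: eqP.
  rewrite (bigD1 (cls z)) //= eqxx mul1r big1 ?addr0 // => g /andP[_ /negPf].
  by rewrite eq_sym => ->; rewrite mul0r.
have q_gt0 : 0 < q%:R :> algC by rewrite ltr0n (ltnW (finNzRing_gt1 F)).
have qk_gt0 : 0 < q%:R ^+ k :> algC by rewrite exprn_gt0.
pose T : algC := (q%:R ^+ (e + e) + C%:R * q%:R ^+ e) / q%:R ^+ k.
have NT g : g \in G -> (N g)%:R <= T.
  by move=> /boundN; rewrite -(ler_nat algC) natrM natrD natrM !natrX -ler_pdivlMr.
have -> : S (e + e) = - \sum_(g in G) (T - (N g)%:R) * 'chi_i g.
  rewrite /point_sum (sumN (fun g => 'chi_i g)); apply/esym/eqP.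
  rewrite eqr_oppLR -subr_eq0 opprK -big_split /=.
  under eq_bigr do rewrite -mulrDl subrK.
  by rewrite -big_distrr /= sum_irr_neq0 // mulr0.
rewrite normrN; apply: le_trans (ler_norm_sum _ _ _) _.
rewrite (eq_bigr (fun g => T - (N g)%:R)) => [|g Gg]; last first.
  by rewrite normrM (normC_lin_char irr_unipotent_lin) // mulr1 ger0_norm // subr_ge0 NT.
rewrite sumrB sumr_const card_unipotent.
have := sumN (fun _ => 1); rewrite big_const_seq count_predT size_frob_points // iter_addr addr0.
under [in X in _ = X -> _]eq_bigr do rewrite mulr1.
by move=> <-; rewrite -[T *+ _]mulr_natr /T !natrX divfK ?gt_eqF // addrC addKr.
Qed.

(** Character sums over monic polynomials of large degree vanish, so Newton's identities give [S d]
    as minus a power sum of [k] numbers. The even power sums are controlled by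
    [point_sum_double_bound], which forces each number to have absolute value at most the square
    root of [q]. *)
Lemma point_sum_bound d : (0 < d)%N -> `|S d| ^+ 2 <= (k ^ 2)%:R * q%:R ^+ d.
Proof.
move=> d_gt0.
pose c m := \sum_(f <- monics F m) class_char f.
have c0 : c 0%N = 1.
  rewrite /c big_monics (eq_bigr (fun _ => 1)) => [|a _].
    by rewrite sumr_const card_ffun card_ord expn0.
  rewrite /class_char (_ : monic_of a = 1) ?(class_of1 iota) //.
    by rewrite (lin_char1 irr_unipotent_lin).
  by rewrite /monic_of big_ord0 addr0 expr0.
have ck j : (k < j)%N -> c j = 0.
  by move/ltnW=> lekj; rewrite /c (sum_class_monics lekj) sum_irr_neq0 ?mulr0.
have := newton_monic_sums iota class_charM.
case/(power_sums_of_newton c0 ck) => s ss Sd.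
have q_gt1 := finNzRing_gt1 F.
have q_gt0 : 0 < q%:R :> algC by rewrite ltr0n ltnW.
have bound_s a : a \in s -> `|a| <= sqrtC q%:R.
  move=> sa; suff: `|a ^+ 2| <= q%:R.
    rewrite normrX -{1}[q%:R]sqrtCK ler_pXn2r ?nnegrE ?normr_ge0 //.
    by rewrite sqrtC_ge0 ltW.
  (* The threshold ensures [k <= e] and [k * k * q + 2 <= e < q ^ e]. The constant may depend on
     [q], since only [e] grows. *)
  apply: (power_sum_bound (s := [seq b ^+ 2 | b <- s]) (n0 := (k + (k * k * q + 3)).+1)
    (K := (1 + q ^ k * (k * q + k * k * q + 2))%:R)) => // [e le_e|]; last exact: map_f.
  have -> : \sum_(x <- [seq b ^+ 2 | b <- s]) x ^+ e = - S (e + e).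
    case: e le_e => // e _; rewrite addSn Sd opprK big_map.
    by apply: eq_bigr => b _; rewrite -exprM mul2n -addnn addSn.
  rewrite normrN; apply: point_sum_double_bound.
    by apply: leq_trans (leq_addr _ _) (ltnW le_e).
  apply: leq_ltn_trans (ltn_expl e q_gt1).
  by move: le_e; lia.
have -> : `|S d| ^+ 2 = `|\sum_(a <- s) a ^+ d| ^+ 2.
  by case: d d_gt0 => // d _; rewrite Sd normrN.
have : `|\sum_(a <- s) a ^+ d| <= k%:R * sqrtC q%:R ^+ d.
  apply: le_trans (ler_norm_sum _ _ _) _.
  apply: (@le_trans _ _ (\sum_(a <- s) sqrtC q%:R ^+ d)); last first.
    by rewrite big_const_seq count_predT ss iter_addr addr0 mulr_natl.
  rewrite !big_seq; apply: ler_sum => a sa; rewrite normrX.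
  by rewrite lerXn2r ?nnegrE ?normr_ge0 ?sqrtC_ge0 ?bound_s // ltW.
move=> le1; apply: le_trans (_ : (k%:R * sqrtC q%:R ^+ d) ^+ 2 <= _).
  rewrite lerXn2r ?nnegrE ?normr_ge0 // mulr_ge0 ?ler0n // exprn_ge0 //.
  by rewrite sqrtC_ge0 ltW.
by rewrite exprMn -exprM mulnC exprM sqrtCK natrX.
Qed.

End CharacterSums.

(** * Tuples permuted by Frobenius *)

Lemma big_orbits (R : Type) (idx : R) (op : Monoid.com_law idx) (T : finType)
    (f : T -> T) (E : T -> R) : injective f ->
  \big[op/idx]_x E x
    = \big[op/idx]_(r | froots f r) \big[op/idx]_(m < fingraph.order f r) E (iter m f r).
Proof.
move=> f_inj; have symf := fconnect_sym f_inj.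
rewrite (partition_big (froot f) (froots f)) /= => [|x _]; last exact: roots_root.
apply: eq_bigr => r /eqP rr.
transitivity (\big[op/idx]_(x <- fingraph.orbit f r) E x).
  rewrite big_uniq ?orbit_uniq //; apply: eq_bigl => x.
  by rewrite -fconnect_orbit -root_connect // rr eq_sym.
rewrite (big_nth r) fingraph.size_orbit big_mkord; apply: eq_bigr => m _.
by rewrite nth_traject.
Qed.

Section CycleSums.
Variables (F : finFieldType) (L : closedFieldType) (iota : {rmorphism F -> L}) (n : nat).
Local Notation q := #|F|.
Local Notation frob := (frob iota).

(** The points of the extension of degree [n!]. Cycle lengths divide [n!], so it contains every
    coordinate of a tuple permuted by Frobenius, and such tuples form a finite type. *)
Definition frob_sub := seq_sub (frob_points iota n`!).

HB.instance Definition _ := Finite.on frob_sub.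

Lemma frob_subP (t : frob_sub) : frob n`! (val t) = val t.
Proof. by apply/eqP; rewrite -mem_frob_points ?fact_gt0 // (valP t). Qed.

Definition tuple_val (z : {ffun 'I_n -> frob_sub}) : {ffun 'I_n -> L} :=
  [ffun i => val (z i)].

Lemma tuple_valE z i : tuple_val z i = val (z i).
Proof. by rewrite ffunE. Qed.

Definition tuple_poly (z : {ffun 'I_n -> frob_sub}) : {poly L} :=
  \prod_(i < n) ('X - (tuple_val z i)%:P).

Definition tuple_poly_over z : {poly F} := map_poly (descend iota) (tuple_poly z).

Lemma descend_iota x : descend iota (iota x) = x.
Proof.
rewrite /descend; case: pickP => [y /eqP/fmorph_inj //|/(_ x)].
by rewrite eqxx.
Qed.

Lemma descend_map (f : {poly F}) : map_poly (descend iota) (map_poly iota f) = f.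
Proof.
apply/polyP=> i; have [lti|lei] := ltnP i (size (map_poly iota f)).
  by rewrite coef_poly lti coef_map descend_iota.
by rewrite coef_poly ltnNge lei [RHS]nth_default //= -(size_map_poly iota).
Qed.

Section OnePermutation.
Variable s : 'S_n.
Local Notation ord := (fingraph.order s).
Implicit Types (y z : {ffun 'I_n -> frob_sub}).

Lemma frob_perm_iter (z : {ffun 'I_n -> L}) m i :
  frob_perm q s z -> frob m (z i) = z (iter m s i).
Proof.
move/forallP=> fz; elim: m => [|m IHm]; first by rewrite frob0.
by rewrite -add1n -frob_comp IHm frobE expn1 (eqP (fz _)).
Qed.

(** Fills each cycle of [s] with the Frobenius iterates of the value at its root. The default [y i]
    is never taken, because [frob_sub] is stable under Frobenius. *)
Definition orbit_spread (y : {ffun 'I_n -> frob_sub}) : {ffun 'I_n -> frob_sub} :=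
  [ffun i => insubd (y i) (frob (findex s (froot s i) i) (val (y (froot s i))))].

Lemma val_orbit_spread y i :
  val (orbit_spread y i) = frob (findex s (froot s i) i) (val (y (froot s i))).
Proof.
rewrite ffunE val_insubd mem_frob_points ?fact_gt0 //.
by rewrite frob_comp addnC -frob_comp frob_subP eqxx.
Qed.

Lemma frob_modn d m x : frob d x = x -> frob (m %% d) x = frob m x.
Proof.
by move=> fx; rewrite [in RHS](divn_eq m d) addnC -frob_comp mulnC frob_fix_iter.
Qed.

Lemma orbit_spread_iter y r m : froots s r -> frob (ord r) (val (y r)) = val (y r) ->
  val (orbit_spread y (iter m s r)) = frob m (val (y r)).
Proof.
move=> /eqP rr fy; have symf := fconnect_sym (@perm_inj _ s).
have Dr : froot s (iter m s r) = r.
  by rewrite -[RHS]rr; apply/esym/(fingraph.rootP symf); apply: fconnect_iter.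
have Dm : iter m s r = iter (m %% ord r) s r.
  rewrite [in LHS](divn_eq m (ord r)) addnC iterD; congr (iter _ _ _).
  elim: (_ %/ _)%N => // d IHd; rewrite mulSn iterD IHd iter_order //; exact: perm_inj.
rewrite val_orbit_spread Dr Dm findex_iter ?ltn_mod ?fingraph.order_gt0 //.
by rewrite frob_modn.
Qed.

Variable t0 : frob_sub.

(** The constant [t0] off the cycle roots makes the restriction an element of a [pfamily], as needed
    to distribute a product over sums. *)
Definition orbit_restrict (z : {ffun 'I_n -> frob_sub}) : {ffun 'I_n -> frob_sub} :=
  [ffun i => if froots s i then z i else t0].

Definition orbit_family (i : 'I_n) : pred frob_sub :=
  [pred t | frob (ord i) (val t) == val t].

Lemma orbit_restrictK z : frob_perm q s (tuple_val z) -> orbit_spread (orbit_restrict z) = z.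
Proof.
move=> fz; have symf := fconnect_sym (@perm_inj _ s).
apply/ffunP=> i; apply: val_inj; rewrite val_orbit_spread ffunE roots_root //.
have := frob_perm_iter (findex s (froot s i) i) (froot s i) fz; rewrite !tuple_valE => ->.
by rewrite iter_findex // symf connect_root.
Qed.

Lemma orbit_spreadE y :
  (frob_perm q s (tuple_val (orbit_spread y)) && (orbit_restrict (orbit_spread y) == y))
    = (y \in pfamily t0 (froots s) orbit_family).
Proof.
have symf := fconnect_sym (@perm_inj _ s).
apply/andP/pfamilyP=> [[fz /eqP ry]|[supp fam]].
  split=> [|r rr].
    apply/subsetP=> i; rewrite inE -ry ffunE; case: ifP => //.
    by rewrite eqxx.
  have yr : tuple_val (orbit_spread y) r = val (y r).
    by have /ffunP/(_ r) := ry; rewrite [orbit_restrict _ _]ffunE ifT // => Er;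
      rewrite tuple_valE Er.
  rewrite inE -yr; have := frob_perm_iter (ord r) r fz.
  by rewrite iter_order; [move=> -> | exact: perm_inj].
have fam' r : froots s r -> frob (ord r) (val (y r)) = val (y r).
  by move=> /fam; rewrite inE => /eqP.
split.
  apply/forallP=> i; rewrite !tuple_valE.
  have [r rr [m ->]] : exists2 r, froots s r & exists m, i = iter m s r.
    exists (froot s i); first exact: roots_root.
    by exists (findex s (froot s i) i); rewrite iter_findex // symf connect_root.
  rewrite -iterS !orbit_spread_iter ?fam' //.
  by rewrite -[q]expn1 -(frobE iota) frob_comp add1n.
apply/eqP/ffunP=> i; rewrite ffunE; case: ifP => [ri|nri].
  by apply: val_inj; have := orbit_spread_iter 0 ri (fam' _ ri); rewrite /= frob0.
by apply/eqP; rewrite eq_sym; apply: contraFT nri => /(subsetP supp).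
Qed.

Lemma tuple_poly_spread y : y \in pfamily t0 (froots s) orbit_family ->
  tuple_poly (orbit_spread y)
    = map_poly iota (\prod_(r | froots s r) charpoly_over iota (ord r) (val (y r))).
Proof.
case/pfamilyP=> supp fam; rewrite /tuple_poly (big_orbits _ _ (@perm_inj _ s)).
rewrite rmorph_prod; apply: eq_bigr => r rr.
have fy : frob (ord r) (val (y r)) = val (y r) by have := fam r rr; rewrite inE => /eqP.
rewrite /= map_charpoly_over //; apply: eq_bigr => m _; congr ('X - _%:P).
by rewrite tuple_valE orbit_spread_iter.
Qed.

End OnePermutation.

Lemma sum_orbit_family (R : nmodType) (s : 'S_n) i (E : L -> R) :
  \sum_(t | orbit_family s i t) E (val t) = \sum_(z <- frob_points iota (fingraph.order s i)) E z.
Proof.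
have ord_gt0 := fingraph.order_gt0 s i; set d := fingraph.order s i in ord_gt0 *.
have dvd_d : (d %| n`!)%N.
  by rewrite dvdn_fact // ord_gt0 /= -[n in (_ <= n)%N]card_ord max_card.
transitivity (\sum_(z <- [seq z <- [seq val t | t : frob_sub] | frob d z == z]) E z).
  by rewrite big_filter big_map big_enum_cond.
apply: perm_big; apply: uniq_perm; rewrite ?frob_points_uniq //.
  by rewrite filter_uniq // map_inj_uniq ?enum_uniq //; apply: val_inj.
move=> z; rewrite mem_filter mem_frob_points //; case: eqP => //= fz.
have fzN : z \in frob_points iota n`!.
  by rewrite mem_frob_points ?fact_gt0 // -(divnK dvd_d) mulnC frob_fix_iter.
by apply/mapP; exists (SeqSub fzN); rewrite ?mem_enum.
Qed.

Variables (R : comNzRingType) (X : {poly F} -> R).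
Hypothesis X1 : X 1 = 1.
Hypothesis XM : forall f g, f \is monic -> g \is monic -> X (f * g) = X f * X g.

(** A tuple on which Frobenius acts as [s] is a free choice, for each cycle of length [d], of a
    point of the extension of degree [d]. Its polynomial is the product of their characteristic
    polynomials, so the sum factors over cycles. *)
Lemma sum_frob_tuples (s : 'S_n) :
  \sum_(z | frob_perm q s (tuple_val z)) X (tuple_poly_over z)
    = \prod_(r | froots s r) point_sum iota X (fingraph.order s r).
Proof.
have t0P : 0 \in frob_points iota n`! by rewrite mem_frob_points ?fact_gt0 // rmorph0.
pose t0 : frob_sub := SeqSub t0P.
have Xprod (I : finType) (P : pred I) (f : I -> {poly F}) :
    (forall i, P i -> f i \is monic) -> X (\prod_(i | P i) f i) = \prod_(i | P i) X (f i).
  move=> mf; suff [] : \prod_(i | P i) f i \is monic /\ X (\prod_(i | P i) f i)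
    = \prod_(i | P i) X (f i) by [].
  elim/big_rec2: _ => [|i x p Pi [mp Xp]]; first by rewrite monic1.
  by rewrite monicMl ?mf // XM ?mf // Xp.
rewrite (reindex_onto (orbit_spread s) (orbit_restrict s t0)); last exact: orbit_restrictK.
rewrite (eq_bigl _ _ (orbit_spreadE s t0)).
transitivity (\prod_(r | froots s r) \sum_(t | orbit_family s r t)
    X (charpoly_over iota (fingraph.order s r) (val t))).
  rewrite (big_distr_big_dep t0); apply: eq_bigr => y fy.
  rewrite /tuple_poly_over (tuple_poly_spread fy) descend_map Xprod // => r rr.
  by apply: charpoly_over_monic; have /pfamilyP[_ /(_ r rr)] := fy; rewrite inE => /eqP.
by apply: eq_bigr => r _; rewrite (sum_orbit_family s r (fun z => X (charpoly_over iota _ z))).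
Qed.

End CycleSums.

(** * Variance over the classes *)

Lemma abelian_second_orthogonality (gT : finGroupType) (G : {group gT}) x y :
    abelian G -> x \in G -> y \in G ->
  \sum_(i : Iirr G) 'chi_i x * ('chi_i y)^* = (#|G| * (x == y))%:R.
Proof.
move=> abG Gx Gy; rewrite second_orthogonality_relation //.
have /cent_classP-> : y \in 'C(G)%g by apply: (subsetP abG).
have -> : ('C_G[x] = G)%g by apply/setIidPl; rewrite sub_cent1 (subsetP abG).
by rewrite inE natrM mulr_natr.
Qed.

Lemma expn_orbits n (s : 'S_n) (Q : nat) :
  (Q ^ n = \prod_(r | froots s r) Q ^ fingraph.order s r)%N.
Proof.
rewrite -{1}(card_ord n) -prod_nat_const (big_orbits _ _ (@perm_inj _ s)) /=.
by apply: eq_bigr => r _; rewrite prod_nat_const card_ord.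
Qed.

Section ShortPolynomials.
Variables (F : finFieldType) (h : nat).

Lemma coef_poly_le_of (b : {ffun 'I_h.+1 -> F}) (i : 'I_h.+1) : (poly_le_of b)`_i = b i.
Proof.
rewrite coef_sum (bigD1 i) //= big1 => [|j ji].
  by rewrite coefZ coefXn eqxx mulr1 addr0.
by rewrite coefZ coefXn eq_sym (inj_eq val_inj) (negPf ji) mulr0.
Qed.

Lemma coef_poly_le_of_gt (b : {ffun 'I_h.+1 -> F}) j : (h < j)%N -> (poly_le_of b)`_j = 0.
Proof.
move=> lthj; rewrite coef_sum big1 // => i _.
by rewrite coefZ coefXn gtn_eqF ?mulr0 // (leq_trans (ltn_ord i)).
Qed.

Lemma poly_le_of_inj : injective (@poly_le_of F h).
Proof. by move=> b c E; apply/ffunP=> i; rewrite -!coef_poly_le_of E. Qed.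

End ShortPolynomials.

Section TupleVariance.
Variables (F : finFieldType) (L : closedFieldType) (iota : {rmorphism F -> L}) (k n : nat).
Hypotheses (k_gt0 : (0 < k)%N) (lekn : (k <= n)%N).
Local Notation q := #|F|.
Local Notation frob := (frob iota).
Local Notation G := (unipotent_group F k).
Variable s : 'S_n.
Local Notation tuple := {ffun 'I_n -> frob_sub iota n}.
Implicit Types (z w : tuple).

Local Notation fixed z := (frob_perm q s (tuple_val z)).

Lemma map_tuple_poly_over z : fixed z -> map_poly iota (tuple_poly_over z) = tuple_poly z.
Proof.
move=> /forallP fz; apply: descendK; rewrite /tuple_poly rmorph_prod.
rewrite [RHS](reindex_inj (@perm_inj _ s)) /=; apply: eq_bigr => i _.
by rewrite rmorphB /= map_polyX map_polyC /= frobE expn1 (eqP (fz i)).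
Qed.

Lemma tuple_poly_over_monic z : fixed z -> tuple_poly_over z \is monic.
Proof.
by move=> fz; rewrite -(map_monic iota) map_tuple_poly_over // monic_prod_XsubC.
Qed.

Lemma size_tuple_poly_over z : fixed z -> size (tuple_poly_over z) = n.+1.
Proof.
move=> fz; rewrite -(size_map_poly iota) map_tuple_poly_over // size_prod_XsubC.
by rewrite /index_enum -enumT size_enum_ord.
Qed.

Lemma card_frob_tuples : #|[pred z : tuple | fixed z]| = (q ^ n)%N.
Proof.
apply/eqP; rewrite -(eqr_nat algC) -sum1_card natr_sum; apply/eqP.
rewrite (sum_frob_tuples iota (X := fun=> 1)) // => [|f g _ _]; last by rewrite mulr1.
rewrite (expn_orbits s) natr_prod; apply: eq_bigr => r _; rewrite /point_sum big_const_seq.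
by rewrite count_predT size_frob_points ?fingraph.order_gt0 // iter_addr addr0.
Qed.

Definition class_count (g : {unit 'M[F]_k.+1}) : nat :=
  #|[pred z : tuple | fixed z & class_of k (tuple_poly_over z) == g]|.

Lemma sum_fixed_class (R : pzSemiRingType) (E : {unit 'M[F]_k.+1} -> R) :
  \sum_(z : tuple | fixed z) E (class_of k (tuple_poly_over z))
    = \sum_(g in G) (class_count g)%:R * E g.
Proof.
rewrite (partition_big (fun z : tuple => class_of k (tuple_poly_over z)) (mem G)) /=; last first.
  by move=> z fz; rewrite class_of_in // tuple_poly_over_monic.
apply: eq_bigr => g _; rewrite (eq_bigr (fun _ => E g)) => [|z /andP[_ /eqP -> //]].
by rewrite sumr_const mulr_natl.
Qed.

Lemma sum_class_count : (\sum_(g in G) class_count g = q ^ n)%N.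
Proof.
have := sum_fixed_class (fun _ => 1%N); rewrite sum1_card card_frob_tuples => ->.
by apply: eq_bigr => g _; rewrite mulr1 natn.
Qed.

Definition tuple_char_sum (i : Iirr G) : algC :=
  \sum_(z : tuple | fixed z) class_char i (tuple_poly_over z).

(** Each cycle of length [d] contributes at most [k ^ 2 * q ^ d <= (k ^ 2 * q) ^ d], and the lengths
    add up to [n]. *)
Lemma tuple_char_sum_bound (i : Iirr G) : i != 0 ->
  `|tuple_char_sum i| ^+ 2 <= ((k ^ 2 * q) ^ n)%:R.
Proof.
move=> i0; rewrite /tuple_char_sum.
have C1 : class_char i 1 = 1.
  by rewrite /class_char (class_of1 iota) (lin_char1 (irr_unipotent_lin i)).
rewrite (sum_frob_tuples iota C1 (class_charM iota i)) normr_prod -prodrXl.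
rewrite (expn_orbits s) natr_prod; apply: ler_prod => r _.
rewrite exprn_ge0 ?normr_ge0 //=.
apply: le_trans (point_sum_bound iota i0 (fingraph.order_gt0 _ _)) _.
rewrite -natrX -natrM ler_nat expnMn leq_mul2r.
by rewrite -{1}[(k ^ 2)%N]expn1 leq_pexp2l ?fingraph.order_gt0 ?expn_gt0 ?k_gt0 // orbT.
Qed.

(** By Plancherel on [G] the left side is the sum of the squared character sums. The trivial
    character gives [q ^ (n + n)], and each of the others is bounded by [tuple_char_sum_bound]. *)
Lemma sum_class_count_sqr :
  (q ^ k * \sum_(g in G) class_count g ^ 2 <= q ^ (n + n) + q ^ k * (k ^ 2 * q) ^ n)%N.
Proof.
rewrite -(ler_nat algC) natrM natr_sum.
have -> : (q ^ k)%:R * \sum_(g in G) (class_count g ^ 2)%:R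
    = \sum_(i : Iirr G) `|tuple_char_sum i| ^+ 2.
  under [RHS]eq_bigr do rewrite normCK /tuple_char_sum rmorph_sum big_distrl /=.
  rewrite exchange_big /=.
  transitivity (\sum_(z : tuple | fixed z)
      ((q ^ k * class_count (class_of k (tuple_poly_over z)))%:R : algC)).
    rewrite (sum_fixed_class (fun g => (q ^ k * class_count g)%:R)) big_distrr /=.
    by apply: eq_bigr => g _; rewrite -!natrM; congr _%:R; rewrite mulnCA mulnn.
  apply: eq_bigr => z fz; under eq_bigr do rewrite big_distrr /=.
  rewrite exchange_big /= -(card_unipotent F k).
  rewrite (eq_bigr (fun w =>
      (#|G| * (class_of k (tuple_poly_over z) == class_of k (tuple_poly_over w)))%:R)).
    rewrite -natr_sum -big_distrr /=; congr (_ * _)%:R.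
    rewrite /class_count -sum1_card [LHS]big_mkcond [RHS]big_mkcond; apply: eq_bigr => w _.
    by rewrite inE /= eq_sym; case: (fixed w) => //=; case: eqP.
  move=> w fw; rewrite abelian_second_orthogonality ?unipotent_abelian //.
    by rewrite class_of_in // tuple_poly_over_monic.
  by rewrite class_of_in // tuple_poly_over_monic.
rewrite (bigD1 0) //= natrD; apply: lerD.
  rewrite /tuple_char_sum (eq_bigr (fun _ => 1)) => [|z fz]; last first.
    by rewrite /class_char irr0 cfun1E class_of_in // tuple_poly_over_monic.
  have -> : \sum_(z : tuple | fixed z) 1 = (q ^ n)%:R :> algC.
    by rewrite -card_frob_tuples -[#|[pred z : tuple | _]|]sum1_card natr_sum.
  by rewrite normr_nat -natrX -expnM muln2 addnn.
apply: (@le_trans _ _ (\sum_(i : Iirr G | i != 0) ((k ^ 2 * q) ^ n)%:R)).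
  by apply: ler_sum => i i0; apply: tuple_char_sum_bound.
apply: (@le_trans _ _ (\sum_(i : Iirr G) ((k ^ 2 * q) ^ n)%:R)).
  by rewrite [leRHS](bigD1 0) //= lerDr ler0n.
rewrite sumr_const card_Iirr_abelian ?unipotent_abelian // card_unipotent.
by rewrite -mulrnA mulnC.
Qed.

Lemma class_count_variance (R : realFieldType) :
  \sum_(a : {ffun 'I_n -> F})
      ((class_count (class_of k (monic_of a)))%:R - q%:R ^+ (n - k)) ^+ 2
    <= ((k ^ 2) ^ n)%:R * q%:R ^+ (n + (n - k)) :> R.
Proof.
rewrite -(big_monics n (fun f => ((class_count (class_of k f))%:R - q%:R ^+ (n - k) : R) ^+ 2)).
rewrite (sum_class_monics lekn (fun g => ((class_count g)%:R - q%:R ^+ (n - k) : R) ^+ 2)).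
have q_gt0 : 0 < q%:R :> R by rewrite ltr0n (ltnW (finNzRing_gt1 F)).
set Q : R := q%:R ^+ (n - k).
have Q_gt0 : 0 < Q by rewrite exprn_gt0.
pose V : R := \sum_(g in G) (class_count g)%:R ^+ 2.
(* [Q] is the mean of [class_count] over [G], so the sum of squared deviations is [V] minus the
   contribution of the mean. *)
have -> : \sum_(g in G) ((class_count g)%:R - Q) ^+ 2 = V - Q * q%:R ^+ n.
  under eq_bigr do rewrite sqrrB.
  rewrite big_split sumrB /= sumr_const card_unipotent -/V -[Q ^+ 2 *+ _]mulr_natr natrX.
  rewrite sumrMnl -big_distrl /= -natr_sum sum_class_count natrX.
  have -> : Q ^+ 2 * q%:R ^+ k = Q * q%:R ^+ n by rewrite expr2 -mulrA -exprD subnK.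
  by ring.
have leV : V <= Q * q%:R ^+ n + ((k ^ 2) ^ n)%:R * q%:R ^+ n.
  rewrite -(ler_pM2l (exprn_gt0 k q_gt0)).
  have := sum_class_count_sqr; rewrite -(ler_nat R) natrM natrX natr_sum.
  under eq_bigr do rewrite natrX.
  move=> le1; apply: (le_trans le1).
  have QE : q%:R ^+ k * Q = q%:R ^+ n by rewrite -exprD subnKC.
  rewrite mulrDr mulrA QE natrD natrM expnMn natrM !natrX exprD.
  by rewrite [_ ^+ k * (_ * _)]mulrCA [_ ^+ k * _]mulrC lexx.
rewrite natrX -/Q exprD -/Q mulrA [leRHS]mulrC ler_pM2l //.
by rewrite lerBlDl.
Qed.

Definition tuple_count (f : {poly F}) : nat :=
  #|[pred z : tuple | fixed z & map_poly iota f == tuple_poly z]|.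

(** Short intervals are the fibres of the class map on monic polynomials of degree [n]. *)
Lemma class_of_eq (f g : {poly F}) :
    f \is monic -> g \is monic -> size f = n.+1 -> size g = n.+1 ->
  class_of k f = class_of k g <-> forall j, (n - k <= j)%N -> f`_j = g`_j.
Proof.
move=> mf mg sf sg; rewrite unipotent_eq ?coef0_rev_coefs //; split=> E.
  move=> j lej; have [lejn|ltnj] := leqP j n; last by rewrite !nth_default ?sf ?sg.
  have lek : (n - j <= k)%N by rewrite leq_subLR addnC -leq_subLR.
  have := E (n - j)%N lek; rewrite !coef_poly sf sg ltnS lek ltnS leq_subr /=.
  by rewrite subKn.
move=> j lejk; rewrite !coef_poly sf sg ltnS lejk ltnS (leq_trans lejk lekn) /=.
by apply: E; rewrite leq_sub2l.
Qed.

(** Each tuple whose polynomial has the class of [monic_of a] is counted for exactly one [b], the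
    difference of the two polynomials. *)
Lemma sum_tuple_count h (a : {ffun 'I_n -> F}) : (n - k)%N = h.+1 ->
  (\sum_(b : {ffun 'I_h.+1 -> F}) tuple_count (monic_of a + poly_le_of b)
    = class_count (class_of k (monic_of a)))%N.
Proof.
move=> Dh; rewrite /tuple_count /class_count.
transitivity (\sum_(b : {ffun 'I_h.+1 -> F}) \sum_(z : tuple | fixed z)
    (map_poly iota (monic_of a + poly_le_of b) == tuple_poly z))%N.
  apply: eq_bigr => b _; rewrite -sum1_card [LHS]big_mkcond [RHS]big_mkcond.
  by apply: eq_bigr => z _; rewrite inE; case: (fixed z) => //=; case: eqP.
rewrite exchange_big /= -[RHS]sum1_card [LHS]big_mkcond [RHS]big_mkcond.
apply: eq_bigr => z _; rewrite inE; case: ifP => //= fz.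
rewrite -(map_tuple_poly_over fz); set f := tuple_poly_over z.
have mf : f \is monic by apply: tuple_poly_over_monic.
have sf : size f = n.+1 by apply: size_tuple_poly_over.
have Ef := class_of_eq mf (monic_of_monic a) sf (size_monic_of a).
have eq_map b : (map_poly iota (monic_of a + poly_le_of b) == map_poly iota f)
    = (monic_of a + poly_le_of b == f).
  exact: inj_eq (map_poly_inj iota) _ _.
under eq_bigr do rewrite eq_map.
have [/Ef E|nE] := eqVneq (class_of k f) (class_of k (monic_of a)); last first.
  rewrite big1 // => b _; apply/eqP; rewrite eqb0; apply: contra nE => /eqP Db.
  apply/eqP/Ef => j; rewrite Dh => lthj.
  by rewrite -Db coefD coef_poly_le_of_gt ?addr0.
pose b0 : {ffun 'I_h.+1 -> F} := [ffun i : 'I_h.+1 => (f - monic_of a)`_i].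
have Db0 : poly_le_of b0 = f - monic_of a.
  apply/polyP=> j; have [ltjh|leh] := ltnP j h.+1.
    by rewrite (coef_poly_le_of _ (Ordinal ltjh)) ffunE.
  by rewrite coef_poly_le_of_gt // coefB E ?Dh // subrr.
rewrite (bigD1 b0) //= Db0 subrKC eqxx big1 // => b bb0.
apply/eqP; rewrite eqb0; apply: contra bb0 => /eqP Db.
by rewrite -(inj_eq (@poly_le_of_inj F h)) Db0 -Db addrC addKr.
Qed.

End TupleVariance.

(** * Short sums *)

Section VonMangoldt.
Variables (F : finFieldType) (L : closedFieldType) (iota : {rmorphism F -> L}) (n : nat).
Local Notation q := #|F|.
Local Notation tuple := {ffun 'I_n -> frob_sub iota n}.

Lemma iter_perm_fact (s : 'S_n) i : iter n`! s i = i.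
Proof.
have dvd_d : (fingraph.order s i %| n`!)%N.
  by rewrite dvdn_fact // fingraph.order_gt0 /= -[n in (_ <= n)%N]card_ord max_card.
rewrite -(divnK dvd_d); elim: (_ %/ _)%N => // d IHd.
by rewrite mulSn iterD IHd iter_order //; apply: perm_inj.
Qed.

Lemma tuple_val_inj : injective (@tuple_val F L iota n).
Proof. by move=> z w E; apply/ffunP=> i; apply: val_inj; rewrite -!tuple_valE E. Qed.

Lemma frob_perm_tuple (s : 'S_n) (z : {ffun 'I_n -> L}) : frob_perm q s z ->
  exists t : tuple, z = tuple_val t.
Proof.
move=> fz; have mz i : z i \in frob_points iota n`!.
  by rewrite mem_frob_points ?fact_gt0 // (frob_perm_iter iota _ _ fz) iter_perm_fact.
exists [ffun i => SeqSub (mz i)]; apply/ffunP=> i.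
by rewrite tuple_valE ffunE.
Qed.

Lemma count_frob_perm (s : 'S_n) (f : {poly F}) (r : seq {ffun 'I_n -> L}) : uniq r ->
    (forall z, z \in r <-> map_poly iota f = \prod_(i < n) ('X - (z i)%:P)) ->
  count (frob_perm q s) r = tuple_count iota s f.
Proof.
move=> uniq_r mem_r; rewrite /tuple_count [RHS]cardE -(size_map (@tuple_val F L iota n)).
rewrite -size_filter.
apply/perm_size/uniq_perm; rewrite ?filter_uniq //.
  by rewrite map_inj_uniq ?enum_uniq //; apply: tuple_val_inj.
move=> z; rewrite mem_filter; apply/andP/mapP => [[fz /mem_r Df]|[t]].
  have [t Dz] := frob_perm_tuple fz; exists t => //.
  by rewrite mem_enum inE -Dz fz Df Dz eqxx.
by rewrite mem_enum inE => /andP[ft /eqP Df] ->; split=> //; apply/mem_r.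
Qed.

(** All tuples with the same polynomial take their coordinates among those of one of them, whence at
    most [n ^ n] tuples. *)
Lemma tuple_count_le (s : 'S_n) (f : {poly F}) : (tuple_count iota s f <= n ^ n)%N.
Proof.
have [->//|] := posnP (tuple_count iota s f).
case/card_gt0P=> z0; rewrite inE => /andP[_ /eqP Df0].
rewrite -[X in (_ <= X ^ _)%N](card_ord n) -[X in (_ <= _ ^ X)%N](card_ord n) -card_ffun.
pose G (g : {ffun 'I_n -> 'I_n}) : tuple := [ffun i => z0 (g i)].
apply: leq_trans (leq_image_card G {: {ffun 'I_n -> 'I_n}}).
apply/subset_leq_card/subsetP=> z; rewrite inE => /andP[_ /eqP Df].
have ex_j i : exists j, z i == z0 j.
  have: (tuple_poly z0).[val (z i)] == 0.
    rewrite -Df0 Df /tuple_poly horner_prod; apply/prodf_eq0; exists i => //.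
    by rewrite tuple_valE hornerXsubC subrr.
  rewrite horner_prod => /prodf_eq0[j _].
  by rewrite hornerXsubC subr_eq0 tuple_valE => E; exists j.
apply/imageP; exists [ffun i => xchoose (ex_j i)] => //.
by apply/ffunP=> i; rewrite !ffunE; apply/eqP/(xchooseP (ex_j i)).
Qed.

End VonMangoldt.

(** * Second-order expansion of a product *)

Section ProductLinearization.
Variable R : realFieldType.

(** Induction on [m]: the new error is the old one times the bounded factor [s m], plus a product of
    first-order terms, which is at most a sum of squares. The constants depend only on [m], [mu] and
    [K]. *)
Lemma prod_linearization m (mu K : nat -> R) :
  exists (l : nat -> R) (C : R), 0 <= C /\
    forall s : nat -> R, (forall i, (i < m)%N -> `|s i| <= K i) ->
    `|\prod_(i < m) s i - \prod_(i < m) mu i - \sum_(i < m) l i * (s i - mu i)|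
      <= C * \sum_(i < m) (s i - mu i) ^+ 2.
Proof.
elim: m => [|m [l [C [C_ge0 IH]]]].
  exists (fun=> 0), 0; split=> // s _.
  by rewrite !big_ord0 !subr0 subrr normr0 mul0r.
pose M := \prod_(i < m) mu i; pose B := \sum_(i < m) `|l i|.
have B_ge0 : 0 <= B by apply: sumr_ge0 => i _.
(* The coefficient of each deviation is the product of the other means. *)
exists (fun i => if (i < m)%N then l i * mu m else M), (C * `|K m| + B).
split=> [|s sK]; first by rewrite addr_ge0 // mulr_ge0.
rewrite !big_ord_recr /= ltnn; under [X in _ - (X + _)]eq_bigr do rewrite ltn_ord.
have := IH s (fun i lti => sK i (ltnW lti)).
have -> : \sum_(i < m) l i * mu m * (s i - mu i) = (\sum_(i < m) l i * (s i - mu i)) * mu m.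
  by rewrite big_distrl /=; apply: eq_bigr => i _; rewrite mulrAC.
set P := \prod_(i < m) s i; set Lam := \sum_(i < m) l i * _; set E := \sum_(i < m) _ ^+ 2.
rewrite -/M => leD; set e := s m - mu m.
have -> : P * s m - M * mu m - (Lam * mu m + M * e) = (P - M - Lam) * s m + Lam * e.
  by rewrite /e; ring.
have E_ge0 : 0 <= E by apply: sumr_ge0 => i _; apply: sqr_ge0.
have leLam : `|Lam * e| <= B * (E + e ^+ 2).
  rewrite /Lam big_distrl /= /B big_distrl /=; apply: le_trans (ler_norm_sum _ _ _) _.
  apply: ler_sum => i _; rewrite -mulrA normrM ler_wpM2l //.
  have leE : (s i - mu i) ^+ 2 <= E.
    rewrite /E (bigD1 i) //= lerDl; apply: sumr_ge0 => j _; exact: sqr_ge0.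
  set x := s i - mu i in leE *.
  have : `|x * e| <= x ^+ 2 + e ^+ 2 by rewrite ler_norml; apply/andP; split; nra.
  by move/le_trans; apply; rewrite lerD2r.
apply: le_trans (ler_normD _ _) _; rewrite normrM.
have leS : `|s m| <= `|K m| by apply: le_trans (sK m _) (ler_norm _).
have := ler_pM (normr_ge0 _) (normr_ge0 _) leD leS.
have := mulr_ge0 (mulr_ge0 C_ge0 (normr_ge0 (K m))) (sqr_ge0 e).
nra.
Qed.

Lemma sqr_sum_le (I : finType) (y : I -> R) :
  (\sum_i y i) ^+ 2 <= #|I|%:R * \sum_i y i ^+ 2.
Proof.
have -> : #|I|%:R * \sum_i y i ^+ 2 = \sum_i \sum_j (y i ^+ 2 + y j ^+ 2) / 2.
  set Y := \sum_i y i ^+ 2.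
  have inner i : \sum_j (y i ^+ 2 + y j ^+ 2) / 2 = (#|I|%:R * y i ^+ 2 + Y) / 2.
    by rewrite -big_distrl big_split /= sumr_const mulr_natl.
  under [RHS]eq_bigr do rewrite inner.
  rewrite -big_distrl big_split /= -big_distrr /= sumr_const -/Y -[Y *+ _]mulr_natl.
  by field.
rewrite expr2 big_distrl /=; apply: ler_sum => i _; rewrite big_distrr /=.
by apply: ler_sum => j _; have := sqr_ge0 (y i - y j); nra.
Qed.

End ProductLinearization.

Section ShortSums.
Variables (F : finFieldType) (R : realType) (n h : nat) (c : 'S_n -> R) (phi : {poly F} -> R).
Hypotheses (ltSh : (h.+1 < n)%N) (phiP : von_mangoldt_type c phi).
Local Notation q := #|F|.

Definition short_sum (a : {ffun 'I_n -> F}) : R :=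
  \sum_(b : {ffun 'I_h.+1 -> F}) phi (monic_of a + poly_le_of b).

Let Q : R := q%:R ^+ h.+1.
Let M : R := \sum_s c s.
Let k := (n - h.+1)%N.

(** A short sum is the combination with coefficients [c s] of the class counts for [s]. The bound
    comes from [tuple_count_le], the mean from the total count [q ^ n], and the variance from
    [class_count_variance] with the Cauchy-Schwarz inequality. *)
Lemma short_sum_facts :
  [/\ forall a, `|short_sum a| <= (\sum_s `|c s|) * (n ^ n)%:R * Q,
      \sum_a (short_sum a - M * Q) = 0
    & \sum_a (short_sum a - M * Q) ^+ 2
        <= #|{: 'S_n}|%:R * (\sum_s c s ^+ 2) * ((k ^ 2) ^ n)%:R * q%:R ^+ n * Q].
Proof.
have k_gt0 : (0 < k)%N by rewrite subn_gt0.
have lekn : (k <= n)%N by rewrite leq_subr.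
have Dh : (n - k = h.+1)%N by rewrite subKn // ltnW.
case: phiP => L [iota [_ phiE]].
have m_add (a : {ffun 'I_n -> F}) (b : {ffun 'I_h.+1 -> F}) :
    monic_of a + poly_le_of b \is monic /\ size (monic_of a + poly_le_of b) = n.+1.
  have sb : (size (poly_le_of b) <= h.+1)%N.
    apply/leq_sizeP => j; exact: coef_poly_le_of_gt.
  have lt_s : (size (poly_le_of b) < size (monic_of a))%N.
    by rewrite size_monic_of (leq_ltn_trans sb) // ltnW // ltnS ltnW.
  rewrite monicE lead_coefDl // size_polyDl // size_monic_of.
  by have := monic_of_monic a; rewrite monicE => ->.
have phi_count f : f \is monic -> size f = n.+1 ->
    phi f = \sum_s c s * (tuple_count iota s f)%:R.
  move=> mf sf; have [r [uniq_r mem_r ->]] := phiE f mf sf.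
  rewrite exchange_big /=; apply: eq_bigr => s _.
  rewrite -big_distrr /= -natr_sum; congr (_ * _%:R).
  by rewrite -(count_frob_perm s uniq_r mem_r) -sum1_count [RHS]big_mkcond.
pose mu (s : 'S_n) (a : {ffun 'I_n -> F}) : R := (class_count iota s (class_of k (monic_of a)))%:R.
have short_mu a : short_sum a = \sum_s c s * mu s a.
  rewrite /short_sum; under eq_bigr do rewrite phi_count ?(m_add _ _).1 ?(m_add _ _).2 //.
  rewrite exchange_big /=; apply: eq_bigr => s _; rewrite -big_distrr /= -natr_sum.
  by rewrite (sum_tuple_count iota lekn s a Dh).
have diffE a : short_sum a - M * Q = \sum_s c s * (mu s a - Q).
  rewrite short_mu /M big_distrl -sumrB; apply: eq_bigr => s _.
  by rewrite mulrBr.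
split=> [a||].
- rewrite /short_sum; apply: le_trans (ler_norm_sum _ _ _) _.
  have -> : (\sum_s `|c s|) * (n ^ n)%:R * Q
      = \sum_(b : {ffun 'I_h.+1 -> F}) (\sum_s `|c s|) * (n ^ n)%:R.
    by rewrite sumr_const card_ffun card_ord -[RHS]mulr_natr !natrX.
  apply: ler_sum => b _; rewrite phi_count ?(m_add _ _).1 ?(m_add _ _).2 //.
  apply: le_trans (ler_norm_sum _ _ _) _; rewrite big_distrl /=.
  apply: ler_sum => s _; rewrite normrM normr_nat ler_wpM2l // ler_nat.
  exact: tuple_count_le.
- under eq_bigr do rewrite diffE.
  rewrite exchange_big big1 //= => s _; rewrite -big_distrr sumrB /=.
  rewrite -(big_monics n (fun f => (class_count iota s (class_of k f))%:R)).
  rewrite (sum_class_monics lekn (fun g => (class_count iota s g)%:R)) -natr_sum.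
  rewrite sum_class_count // Dh sumr_const card_ffun card_ord -[Q *+ _]mulr_natr /Q !natrX.
  by rewrite subrr mulr0.
apply: (@le_trans _ _ (\sum_a #|{: 'S_n}|%:R * \sum_s (c s * (mu s a - Q)) ^+ 2)).
  by apply: ler_sum => a _; rewrite diffE; apply: sqr_sum_le.
rewrite -big_distrr /= -!mulrA ler_wpM2l // exchange_big /= big_distrl /=.
apply: ler_sum => s _; under eq_bigr do rewrite exprMn.
rewrite -big_distrr /= ler_wpM2l ?sqr_ge0 //.
have := class_count_variance iota k_gt0 lekn s R.
by rewrite Dh exprD.
Qed.

End ShortSums.

(** * The mean of a product of short sums *)

Theorem theorem4p4 (R : realType) (m n h : nat)
  (hm : (2 <= m)%N) (hn : (4 <= n)%N) (hh1 : (1 <= h)%N) (hh2 : (h <= n - 3)%N)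
  (c : 'I_m -> 'S_n -> R) :
  exists (C : R) (Q0 : nat),
    forall (F : finFieldType),
      (Q0 <= #|F|)%N ->
      ((3 <= m)%N -> forall p : nat, p \in [pchar F] -> (n < p)%N) ->
      forall phi : 'I_m -> {poly F} -> R,
        (forall i, von_mangoldt_type (c i) (phi i)) ->
        let q : R := (#|F|)%:R in
        `| (q ^+ n)^-1 *
             \sum_(a : {ffun 'I_n -> F})
               \prod_(i < m) \sum_(b : {ffun 'I_h.+1 -> F})
                   phi i (monic_of a + poly_le_of b)
           - \prod_(i < m) (\sum_(tau : 'S_n) c i tau * q ^+ h.+1) |
        <= C * q ^+ (h.+1 * (m - 1)).
Proof.
have ltSh : (h.+1 < n)%N by lia.
pose mean i : R := \sum_s c i s.
pose K i : R := (\sum_s `|c i s|) * (n ^ n)%:R.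
pose V i : R := #|{: 'S_n}|%:R * (\sum_s c i s ^+ 2) * (((n - h.+1) ^ 2) ^ n)%:R.
(* [prod_linearization] takes families indexed by natural numbers, so families over ['I_m] are
   extended by [0]. *)
pose ext (f : 'I_m -> R) (j : nat) := if insub j is Some i then f i else 0.
have extE f (i : 'I_m) : ext f i = f i by rewrite /ext valK.
have [l [C [C_ge0 linC]]] := prod_linearization m (ext mean) (ext K).
exists (C * \sum_i V i), 0%N => F _ _ phi phiP; cbv zeta; set q : R := #|F|%:R.
have q_gt0 : 0 < q by rewrite ltr0n (ltnW (finNzRing_gt1 F)).
pose Q := q ^+ h.+1; have Q_gt0 : 0 < Q by rewrite exprn_gt0.
have Q_neq0 : Q != 0 by rewrite gt_eqF.
have qn_gt0 : 0 < q ^+ n by rewrite exprn_gt0.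
have qn_neq0 : q ^+ n != 0 by rewrite gt_eqF.
have prod_scale (f : 'I_m -> R) : \prod_i (Q * f i) = Q ^+ m * \prod_i f i.
  by rewrite big_split prodr_const card_ord.
pose S i (a : {ffun 'I_n -> F}) := short_sum h (phi i) a.
(* Dividing by [Q] makes the bounds [K i] and the means independent of [F], as the constants fixed
   beforehand require. *)
pose s i a := S i a / Q.
have sE i a : s i a - mean i = (S i a - mean i * Q) / Q by rewrite mulrBl mulfK.
have sK i a : `|s i a| <= K i.
  have [/(_ a) leS _ _] := short_sum_facts ltSh (phiP i).
  by rewrite normrM normfV (gtr0_norm Q_gt0) ler_pdivrMr.
have s0 i : \sum_a (s i a - mean i) = 0.
  have [_ S0 _] := short_sum_facts ltSh (phiP i).
  by under eq_bigr do rewrite sE; rewrite -big_distrl /= S0 mul0r.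
have s2 i : \sum_a (s i a - mean i) ^+ 2 <= V i * q ^+ n / Q.
  have [_ _ S2] := short_sum_facts ltSh (phiP i).
  under eq_bigr do rewrite sE expr_div_n.
  rewrite -big_distrl /= ler_pdivrMr ?exprn_gt0 // expr2 mulrA divfK //.
pose D a := \prod_(i < m) s i a - \prod_(i < m) mean i
  - \sum_(i < m) l i * (s i a - mean i).
have leD a : `|D a| <= C * \sum_(i < m) (s i a - mean i) ^+ 2.
  have -> : D a = \prod_(i < m) ext (s^~ a) i - \prod_(i < m) ext mean i
      - \sum_(i < m) l i * (ext (s^~ a) i - ext mean i).
    by congr (_ - _ - _); apply: eq_bigr => i _; rewrite !extE.
  have -> : \sum_(i < m) (s i a - mean i) ^+ 2
      = \sum_(i < m) (ext (s^~ a) i - ext mean i) ^+ 2.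
    by apply: eq_bigr => i _; rewrite !extE.
  by apply: linC => i lti; rewrite -[i]/(Ordinal lti : nat) !extE.
(* Summed over [a], the linear terms vanish by [s0], leaving only the second-order remainders
   [D a]. *)
have -> : (q ^+ n)^-1 * \sum_(a : {ffun 'I_n -> F}) \prod_(i < m)
       \sum_(b : {ffun 'I_h.+1 -> F}) phi i (monic_of a + poly_le_of b)
     - \prod_(i < m) (\sum_tau c i tau * q ^+ h.+1)
   = Q ^+ m / q ^+ n * \sum_a D a.
  have -> : \sum_a D a = \sum_a \prod_(i < m) s i a - q ^+ n * \prod_(i < m) mean i.
    rewrite /D sumrB sumrB exchange_big /= [X in _ - _ - X]big1 ?subr0 => [|i _].
      by rewrite sumr_const card_ffun card_ord -[_ *+ _]mulr_natl natrX.
    by rewrite -big_distrr /= s0 mulr0.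
  rewrite mulrBr; congr (_ - _).
    rewrite [Q ^+ m / _]mulrC -mulrA; congr (_ * _); rewrite big_distrr /=.
    apply: eq_bigr => a _; rewrite -prod_scale.
    by apply: eq_bigr => i _; rewrite mulrC divfK.
  rewrite mulrA divfK // -prod_scale.
  by apply: eq_bigr => i _; rewrite -big_distrl /= mulrC.
rewrite normrM ger0_norm; last by rewrite divr_ge0 ?exprn_ge0 // ltW.
have sumD : `|\sum_a D a| <= C * (\sum_i V i) * q ^+ n / Q.
  apply: le_trans (ler_norm_sum _ _ _) _.
  apply: (@le_trans _ _ (\sum_a C * \sum_(i < m) (s i a - mean i) ^+ 2)).
    by apply: ler_sum => a _.
  rewrite -big_distrr /= -!mulrA ler_wpM2l // exchange_big /= big_distrl /=.
  by apply: ler_sum => i _; rewrite mulrA.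
have := ler_wpM2l (_ : 0 <= Q ^+ m / q ^+ n) sumD.
rewrite divr_ge0 ?exprn_ge0 ?(ltW Q_gt0) ?(ltW q_gt0) // => /(_ isT) /le_trans; apply.
(* The variance bound saves one factor [Q] against the main order [Q ^ m]. *)
have -> : q ^+ (h.+1 * (m - 1)) = Q ^+ m / Q.
  by rewrite exprM -/Q -{2}(subnK (ltnW hm)) exprD expr1 mulfK.
rewrite le_eqVlt; apply/orP; left; apply/eqP.
by field; rewrite qn_neq0 Q_neq0.
Qed.
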